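(* Let $n\ge 2$ and let $S$ be a partially bounded subset of $Z^{2n}(\pi)$. Put $$\sigma_H(S)=\inf_{H}\Big\{\sup_{x\in\mathbb{R}^{2n-2}}\overline{\mu}\big(p(\phi_H(S)\cap D_x)\big)+\|H\|\Big\},$$ $$\hat\sigma_H(S)=\inf_{H}\Big\{\sup_{x\in\mathbb{R}^{2n-2}}\hat\mu\big(p(\phi_H(S)\cap D_x)\big)+\|H\|\Big\},$$ where $H$ varies over $\mathcal{H}_c(2n)$ if $S$ is bounded and over $\mathcal{H}(2n)$ if $S$ is unbounded. Then: (i) $\sigma_H(S)=0$. (ii) $\hat\sigma_H(S)=0$ if $S\subset Z^{2n}(a)$ for some $a<\pi$.
   Context: $\mathbb{R}^{2n}$ has coordinates $(x_1,y_1,\dots,x_n,y_n)$ and carries the standard symplectic form $\omega_0=\sum_{i=1}^n dx_i\wedge dy_i$. $B^2(\pi r^2)\subset\mathbb{R}^2$ denotes the closed disc of radius $r$ centred at the origin (so $B^2(a)$ has area $a$), $Z^{2n}(a)=B^2(a)\times\mathbb{R}^{2n-2}$ is the closed symplectic cylinder (the disc factor lying in the $(x_1,y_1)$-plane), $p\colon Z^{2n}(\pi)\to B^2(\pi)$ is the projection to the first factor, and $D_x=B^2(\pi)\times\{x\}$ for $x\in\mathbb{R}^{2n-2}$. A subset $S$ of $Z^{2n}(\pi)$ is partially bounded if at least one of the coordinate functions $x_2,\dots,x_n,y_2,\dots,y_n$ is bounded on $S$. For a smooth function $H\colon\mathbb{R}^{2n}\to\mathbb{R}$ the (time-independent) Hamiltonian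 vector field $X_H$ is defined by $\omega_0(X_H(z),\cdot)=dH(z)$. $\mathcal{H}_c(2n)$ is the set of smooth functions $H\colon\mathbb{R}^{2n}\to\mathbb{R}$ whose support is a compact subset of $Z^{2n}(\pi)$. $\mathcal{H}(2n)$ is the set of smooth and bounded functions $H\colon\mathbb{R}^{2n}\to\mathbb{R}$ whose support is contained in $Z^{2n}(\pi)$ and whose Hamiltonian vector field $X_H$ generates a (globally defined) flow on $\mathbb{R}^{2n}$. In both cases $\phi_H$ is the time-1-map of this flow, and $\|H\|=\sup_{z\in\mathbb{R}^{2n}}H(z)-\inf_{z\in\mathbb{R}^{2n}}H(z)$. $\mu$ is Lebesgue measure on $\mathbb{R}^2$ and $\overline{\mu}$ is outer Lebesgue measure on $\mathbb{R}^2$. For $T\subset\mathbb{R}^2$ the simply connected hull $\widehat T$ is the union of the closure $\overline T$ and the bounded components of $\mathbb{R}^2\setminus\overline T$, and $\hat\mu(T)=\mu(\widehat T)$. *)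

(* Defs.v *)
From mathcomp Require Import all_boot all_order all_algebra.
From mathcomp Require Import all_classical all_reals all_analysis.

Set Implicit Arguments.
Unset Strict Implicit.
Unset Printing Implicit Defensive.

Import Order.TTheory GRing.Theory Num.Theory.
Import numFieldNormedType.Exports.

Local Open Scope classical_set_scope.
Local Open Scope ring_scope.

(* R^2n as n x 2 matrices: row i is the pair (x_(i+1), y_(i+1)), so that the
   (x_1, y_1)-plane is row ord0. *)
Notation phase_space R n := 'M[R]_(n, 2).

Section HamiltonianFlows.
Context {R : realType} {n : nat}.
Notation V := (phase_space R n).
Implicit Types (H : V -> R) (X : V -> V) (phi : R -> V -> V).

Definition omega0 (u v : V) : R := \sum_i (u i 0 * v i 1 - u i 1 * v i 0).

Fixpoint C_k (k : nat) H : Prop :=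
  if k is k'.+1 then
    (forall z, differentiable H z) /\ (forall v, C_k k' ('D_v H))
  else continuous H.

Definition smooth H := forall k, C_k k H.

Definition supp H : set V := closure [set z | H z != 0].

Definition is_hamiltonian_vf H X := forall z v, omega0 (X z) v = 'd H z v.

Definition is_flow X phi :=
  (forall z, phi 0 z = z) /\
  (forall z (t : R), is_derive t 1 (phi ^~ z) (X (phi t z))).

Definition is_hamiltonian_flow H phi :=
  exists2 X, is_hamiltonian_vf H X & is_flow X phi.

(* psi = phi_H.  For smooth H the field X_H is unique (omega0 is nondegenerate)
   and locally Lipschitz, so its global flow is unique when it exists. *)
Definition is_time1_map H (psi : V -> V) :=
  exists2 phi, is_hamiltonian_flow H phi & psi = phi 1.

Definition Hnorm H : \bar R :=
  (ereal_sup [set (H z)%:E | z in setT] -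
   ereal_inf [set (H z)%:E | z in setT])%E.

End HamiltonianFlows.

Section Plane.
Context {R : realType}.

(* The closed disc of area a, i.e. of radius r with a = pi r^2. *)
Definition disc (a : R) : set (R * R) :=
  [set w | pi * (w.1 ^+ 2 + w.2 ^+ 2) <= a].

Definition lebesgue2 : {measure set (measurableTypeR R * measurableTypeR R)
    -> \bar R} :=
  (@lebesgue_measure R \x @lebesgue_measure R)%E.

Definition outer_lebesgue2 : set (R * R) -> \bar R := mu_ext lebesgue2.

Definition components (A : set (R * R)) : set (set (R * R)) :=
  [set connected_component A w | w in A].

Definition hull (T : set (R * R)) : set (R * R) :=
  closure T `|`
  \bigcup_(C in [set C | components (~` closure T) C /\ bounded_set C]) C.

Definition mu_hat (T : set (R * R)) : \bar R := lebesgue2 (hull T).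

End Plane.

Section Cylinder.
Context {R : realType} {n : nat}.
Notation V := (phase_space R n.+1).
Implicit Types (S : set V) (H : V -> R).

(* The projection p is total here; it is only applied to subsets of the
   fibers below, which lie in the cylinder. *)
Definition plane_proj (z : V) : R * R := (z ord0 0, z ord0 1).

Definition cylinder (a : R) : set V := [set z | disc a (plane_proj z)].

(* D_x, with x ranging over R^(2n) inside R^(2(n+1)). *)
Definition fiber (x : phase_space R n) : set V :=
  [set z | disc pi (plane_proj z) /\ row' ord0 z = x].

Definition partially_bounded S :=
  exists i j, i != ord0 /\ bounded_set [set z i j | z in S].

Definition Hc : set (V -> R) :=
  [set H | [/\ smooth H, compact (supp H) & supp H `<=` cylinder pi]].

Definition Hb : set (V -> R) :=
  [set H | [/\ smooth H, bounded_fun H, supp H `<=` cylinder pi &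
               exists phi, is_hamiltonian_flow H phi]].

Definition hamiltonians S : set (V -> R) :=
  [set H | (bounded_set S -> Hc H) /\ (~ bounded_set S -> Hb H)].

Definition section_inf (m : set (R * R) -> \bar R) S : \bar R :=
  ereal_inf [set (ereal_sup [set m (plane_proj @` (Hpsi.2 @` S `&` fiber x))
                            | x in setT] + Hnorm Hpsi.1)%E
            | Hpsi in [set Hpsi : (V -> R) * (V -> V) |
                         hamiltonians S Hpsi.1 /\
                         is_time1_map Hpsi.1 Hpsi.2]].

Definition sigma_H : set V -> \bar R := section_inf outer_lebesgue2.

Definition sigma_hat_H : set V -> \bar R := section_inf mu_hat.

End Cylinder.

(* Main.v *)
Require Import Defs.
From HB Require Import structures.
From mathcomp Require Import all_boot all_order all_algebra.
From mathcomp Require Import all_classical all_reals all_analysis.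
From mathcomp Require Import measurable_realfun ring lra.

Set Implicit Arguments.
Unset Strict Implicit.
Unset Printing Implicit Defensive.

Import Order.TTheory GRing.Theory Num.Theory.
Import numFieldNormedType.Exports.

Local Open Scope classical_set_scope.
Local Open Scope ring_scope.

(** Write w = z_0 for the component in the (x_1, y_1)-plane, and let z_i be the
    pair of coordinates one of which is bounded on S.  The Hamiltonian
    H = e sin (N k(z_i) + K(w)), cut off by functions of conserved quantities,
    is integrable: its flow moves z_i by the flow of k during the time
    e N cos (N k + K), and w by the flow of K, so that k(z_i) and K(w) are
    conserved.  Here k is a linear coordinate (or, if S is bounded, the squared
    distance to a point far away), and e N is of fixed size while e is small.
    In a fiber D_x the endpoint of z_i is fixed and its starting point is
    confined by the hypothesis on S, so cos (kappa + K(w)), with kappa given by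
    x, takes nearly the same value on the whole section.  As 0 <= K <= 1, this
    confines K(w) to two short intervals, and the section to a thin set.

    For the simply connected hull, K is the squared radius conjugated by an area
    preserving twist of the disc which moves the centre of the circles to a
    point outside of B^2(a).  Every level curve of K then leaves B^2(a), so that
    removing from the plane the part of B^2(a) where K lies in two closed
    intervals does not disconnect it. *)

(** * Smooth functions and cut-offs *)

(** The norm of H sees only the amplitude e, whereas the displacement of z_i sees e N; this is why a
    rapid oscillation moves z_i by a fixed amount at almost no cost. Cut-offs have to be functions
    of conserved quantities, since otherwise the flow is no longer explicit. A nonzero function of a
    linear coordinate never has compact support in the plane of z_i; for bounded S, where compact
    support is required, the translation is therefore replaced by a rotation, and the far centre
    makes it resemble a translation on S. Two intervals appear because cos takes no value more than
    twice on an interval of length 1. With the plain squared radius for K, sections would be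
    confined to thin annuli, whose hulls may be large discs; this is the obstacle that the twist
    removes. Within one fiber the motion of w takes a time that depends on K(w) alone, so it extends
    to a homeomorphism of the plane which preserves K, and connected complements remain connected.
    The area of the sets where K is close to a value is bounded uniformly in that value by an
    averaging over rotations about the centre of the twist. *)

Section Smoothness.
Context {R : realType} {n : nat}.
Notation V := (phase_space R n).
Implicit Types (F G : V -> R) (g : R -> R).

Lemma C_kW k F : C_k k.+1 F -> C_k k F.
Proof.
elim: k F => [|k IH] F [dF DF]; first by move=> z; exact: (differentiable_continuous (dF z)).
by split=> // v; exact/IH/DF.
Qed.

Lemma C_k_cst k (a : R) : C_k k (cst a : V -> R).
Proof.
elim: k a => [|k IH] a; first by move=> z; exact: cst_continuous.
split=> [z|v]; first exact: differentiable_cst.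
rewrite (_ : 'D_v (cst a) = cst 0); first exact: IH.
by apply/funext => z; rewrite derive_cst.
Qed.

Lemma C_kD k F G : C_k k F -> C_k k G -> C_k k (F \+ G).
Proof.
elim: k F G => [|k IH] F G; first by move=> cF cG z; exact: (continuousD (cF z) (cG z)).
move=> /= [dF DF] [dG DG]; split=> [z|v]; first exact: (differentiableD (dF z) (dG z)).
rewrite (_ : 'D_v (F \+ G) = 'D_v F \+ 'D_v G); first exact: IH.
by apply/funext => z; apply: (deriveD (diff_derivable (dF z)) (diff_derivable (dG z))).
Qed.

Lemma C_kM k F G : C_k k F -> C_k k G -> C_k k (F \* G).
Proof.
elim: k F G => [|k IH] F G.
  by move=> cF cG z; exact: (continuousM (cF z) (cG z)).
move=> cF cG; have /= [dF DF] := cF; have /= [dG DG] := cG.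
split=> [z|v]; first exact: (differentiableM (dF z) (dG z)).
rewrite (_ : 'D_v (F \* G) = (F \* 'D_v G) \+ (G \* 'D_v F)).
  by apply: C_kD; apply: IH => //; exact: C_kW.
by apply/funext => z; apply: (deriveM (diff_derivable (dF z)) (diff_derivable (dG z))).
Qed.

(** A sequence of functions, each the derivative of the one before, stands for a smooth function on
    the line. Differentiating [g_ j \o F] produces [g_ j.+1 \o F] times a derivative of [F], so the
    induction on [k] has to range over all [j]. *)
Lemma C_k_comp_seq k (g_ : nat -> R -> R) F :
  (forall j (x : R), is_derive x 1 (g_ j) (g_ j.+1 x)) ->
  C_k k F -> forall j, C_k k (g_ j \o F).
Proof.
move=> dg; have dgd j (x : R) : differentiable (g_ j) x.
  by apply/derivable1_diffP; apply: ex_derive.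
elim: k F => [|k IH] F.
  move=> cF j z; apply: continuous_comp; first exact: cF.
  exact: (differentiable_continuous (dgd _ _)).
move=> cF; have /= [dF DF] := cF => j.
split=> [z|v]; first exact: (differentiable_comp (dF _) (dgd _ _)).
rewrite (_ : 'D_v (g_ j \o F) = (g_ j.+1 \o F) \* 'D_v F).
  by apply: C_kM => //; apply: IH; exact: C_kW.
apply/funext => z; rewrite deriveE; last exact: (differentiable_comp (dF _) (dgd _ _)).
rewrite diff_comp // deriv1E; last exact: ex_derive.
by rewrite /= -deriveE // derive1E derive_val mulrC.
Qed.

Lemma smooth_cst (a : R) : smooth (cst a : V -> R).
Proof. by move=> k; exact: C_k_cst. Qed.

Lemma smoothD F G : smooth F -> smooth G -> smooth (F \+ G).
Proof. by move=> sF sG k; exact: C_kD. Qed.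

Lemma smoothM F G : smooth F -> smooth G -> smooth (F \* G).
Proof. by move=> sF sG k; exact: C_kM. Qed.

Lemma smooth_comp_seq (g_ : nat -> R -> R) F :
  (forall j (x : R), is_derive x 1 (g_ j) (g_ j.+1 x)) ->
  smooth F -> smooth (g_ 0%N \o F).
Proof. by move=> dg sF k; apply: C_k_comp_seq. Qed.

Lemma diff_coord (i : 'I_n) (j : 'I_2) (z : V) :
  'd (fun M : V => M i j) z = (fun v : V => v i j) :> (V -> R).
Proof.
have lin : linear (fun M : V => M i j) by move=> a u v; rewrite !mxE.
pose f : {linear V -> R} := HB.pack (fun M : V => M i j)
  (GRing.isLinear.Build _ _ _ _ (fun M : V => M i j) lin).
rewrite (_ : (fun M : V => M i j) = f) // diff_lin //.
exact: coord_continuous.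
Qed.

Lemma smooth_coord (i : 'I_n) (j : 'I_2) : smooth (fun M : V => M i j).
Proof.
case=> [|k]; first exact: coord_continuous.
split=> [z|v]; first exact: differentiable_coord.
rewrite (_ : 'D_v _ = cst (v i j)); first exact: C_k_cst.
apply/funext => z; rewrite deriveE; last exact: differentiable_coord.
by rewrite diff_coord.
Qed.

Lemma smooth_diff F z : smooth F -> differentiable F z.
Proof. by move=> /(_ 1%N) []. Qed.

(** [smooth] speaks of functions on the phase space; smooth functions of one real variable enter
    through their composites. *)
Definition preserves_smooth g := forall F, smooth F -> smooth (g \o F).

Lemma preserves_smooth_comp g h :
  preserves_smooth g -> preserves_smooth h -> preserves_smooth (g \o h).
Proof. by move=> sg sh F sF; exact: (sg _ (sh _ sF)). Qed.

Lemma preserves_smooth_affine (a b : R) : preserves_smooth (fun x => a * x + b).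
Proof.
move=> F sF; apply: (smoothD (F := fun z => a * F z)); last exact: smooth_cst.
by apply: smoothM => //; exact: smooth_cst.
Qed.

Lemma preserves_smooth_cst (a : R) : preserves_smooth (cst a).
Proof. by move=> F sF; exact: smooth_cst. Qed.

Lemma preserves_smooth_sin : preserves_smooth (@sin R).
Proof.
pose s := fix s j : R -> R := if j is j'.+1 then
  (if j' is j''.+1 then \- s j'' else @cos R) else @sin R.
have ds : forall j (x : R), is_derive x 1 (s j) (s j.+1 x).
  (* The recursion defining [s] goes back two steps, so two consecutive derivatives are established
     together. *)
  suff H j : (forall x : R, is_derive x 1 (s j) (s j.+1 x)) /\
             (forall x : R, is_derive x 1 (s j.+1) (s j.+2 x)).
    by move=> j; have [] := H j.
  elim: j => [|j [IH1 IH2]]; split=> x //=.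
  - exact: is_derive_sin.
  - exact: is_derive_cos.
  - exact: (is_deriveN (IH1 x)).
by move=> F; exact: (smooth_comp_seq ds).
Qed.

Lemma preserves_smooth_cos : preserves_smooth (@cos R).
Proof.
have -> : @cos R = @sin R \o (fun x => 1 * x + pi / 2).
  by apply/funext => x /=; rewrite mul1r sinDpihalf.
exact: (preserves_smooth_comp preserves_smooth_sin (preserves_smooth_affine _ _)).
Qed.

End Smoothness.

Section Cutoff.
Context {R : realType}.
Implicit Types (p : {poly R}) (x : R).

(** Half of the exponent absorbs the polynomial of lower degree, the other half absorbs the
    additional factor [y]. *)
Lemma horner_le_expR p (e : R) : 0 < e ->
  exists C, forall y, 0 <= y -> `|p.[y]| <= C * expR (e * y).
Proof.
elim/poly_ind: p e => [|p c IH] e e0.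
  by exists 0 => y y0; rewrite horner0 normr0 mul0r.
have e20 : 0 < e / 2 by rewrite divr_gt0.
have [C HC] := IH _ e20.
exists (2 / e * `|C| + `|c|) => y y0.
rewrite hornerMXaddC (le_trans (ler_normD _ _))// mulrDl lerD//; last first.
  by rewrite ler_peMr// -expR0 ler_expR mulr_ge0// ltW.
rewrite normrM (ger0_norm y0).
have -> : e * y = e / 2 * y + e / 2 * y by field.
rewrite expRD.
have Hy : y <= 2 / e * expR (e / 2 * y).
  have -> : y = 2 / e * (e / 2 * y) by field; rewrite gt_eqF.
  rewrite ler_pM2l ?divr_gt0//.
  have -> : e / 2 * (2 / e * (e / 2 * y)) = e / 2 * y by field; rewrite gt_eqF.
  by rewrite (le_trans _ (expR_ge1Dx _))// lerDr.
have HC' : `|p.[y]| <= `|C| * expR (e / 2 * y).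
  by rewrite (le_trans (HC _ y0))// ler_wpM2r ?expR_ge0// ler_norm.
have := ler_pM (normr_ge0 _) y0 HC' Hy.
by congr (_ <= _); ring.
Qed.

(** With a polynomial parameter the functions p(1/x) exp(-1/x) form a family closed under
    differentiation, so all derivatives of the classical flat function [flat 1] are available at
    once. *)
Definition flat p x := if 0 < x then p.[x^-1] * expR (- x^-1) else 0.

(** The decay of exp(-1/x) is played against p times X^2 at 1/x. A quadratic bound is what forces
    the derivative at 0 to exist and vanish. *)
Lemma flat_le_sqr p : exists C, forall x, `|flat p x| <= C * x ^+ 2.
Proof.
have [C HC] := horner_le_expR (p * 'X^2) ltr01.
exists `|C| => x; rewrite /flat; case: ifPn => [x0|_]; last first.
  by rewrite normr0 mulr_ge0// sqr_ge0.
have := HC x^-1; rewrite invr_ge0 ltW// => /(_ isT).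
rewrite hornerM hornerXn normrM mul1r.
rewrite normrX normfV (gtr0_norm x0) normrM (ger0_norm (expR_ge0 _)) expRN => H.
rewrite -ler_pdivlMr ?invr_gt0 ?expR_gt0// invrK mulrAC -ler_pdivrMr ?exprn_gt0//.
by rewrite -exprVn (le_trans H)// ler_wpM2r ?expR_ge0// ler_norm.
Qed.

Lemma is_derive_le_sqr (f : R -> R) (C : R) :
  (forall x, `|f x| <= C * x ^+ 2) -> is_derive (0 : R) (1 : R) f 0.
Proof.
move=> fC; have f0 : f 0 = 0.
  by apply/eqP; rewrite -normr_le0 (le_trans (fC 0))// expr0n mulr0.
have cv : (fun h : R => h^-1 *: ((f \o shift 0) (h *: 1) - f 0)) @ 0^' --> (0 : R).
  apply/cvgrPdist_le => /= e e0.
  near=> h.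
  have h0 : h != 0 by near: h; exact: nbhs_dnbhs_neq.
  rewrite sub0r normrN f0 subr0 addr0 /GRing.scale /= mulr1 normrM normfV.
  rewrite mulrC ler_pdivrMr ?normr_gt0//.
  rewrite (le_trans (fC h))// -[h ^+ 2]real_normK ?num_real// expr2 mulrA ler_wpM2r//.
  have C1 : 0 < `|C| + 1 by rewrite ltr_wpDl.
  have : `|h| <= e / (`|C| + 1).
    near: h; apply: dnbhs0_le; exact: divr_gt0.
  rewrite ler_pdivlMr// => H.
  rewrite (le_trans _ H)// mulrC ler_wpM2l//.
  by rewrite (le_trans (ler_norm C))// lerDl.
apply: DeriveDef; first by apply/cvg_ex; exists 0.
exact/cvg_lim.
Unshelve. all: by end_near. Qed.

Lemma is_derive_flat p x :
  is_derive x (1 : R) (flat p) (flat ('X^2 * (p - p^`())) x).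
Proof.
have [x0|x0|x0] := ltgtP x 0.
- rewrite /flat (ltNge 0 x) (ltW x0) /=.
  apply: (@near_eq_is_derive _ _ _ (cst 0)).
    have : \forall y \near x, y < 0 by apply: open_nbhs_nbhs; split => //; exact: open_lt.
    by apply: filterS => y y0; rewrite ifF//; apply/negbTE; rewrite -leNgt ltW.
- rewrite {2}/flat x0.
  apply: (@near_eq_is_derive _ _ _ (fun y : R => p.[y^-1] * expR (- y^-1) : R)).
    have : \forall y \near x, 0 < y by apply: open_nbhs_nbhs; split => //; exact: open_gt.
    by apply: filterS => y y0; rewrite /flat y0.
  have xn0 : x != 0 by rewrite gt_eqF.
  have dV : is_derive x (1 : R) (fun y : R => y^-1) (- x ^- 2).
    have := is_deriveV xn0 (is_derive_id x (1 : R)).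
    by move/is_derive_eq; apply; rewrite /GRing.scale /= mulr1.
  have dp : is_derive x (1 : R) (fun y : R => p.[y^-1]) (- x ^- 2 * p^`().[x^-1]).
    rewrite mulrC; exact: (is_derive1_comp (is_derive_poly p (x^-1)) dV).
  have de : is_derive x (1 : R) (fun y : R => expR (- y^-1)) (x ^- 2 * expR (- x^-1)).
    have dN := is_deriveN dV; rewrite opprK in dN.
    by rewrite mulrC; exact: (@is_derive1_comp _ expR (fun y : R => - y^-1) x _ _ (is_derive_expR _) dN).
  have := is_deriveM dp de; move/is_derive_eq; apply.
  rewrite !hornerE exprVn.
  transitivity (p.[x^-1] * (x ^- 2 * expR (- x^-1)) +
    expR (- x^-1) * (- x ^- 2 * p^`().[x^-1])); first by [].
  by ring.
- rewrite x0 {2}/flat ltxx.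
  have [C HC] := flat_le_sqr p.
  exact: is_derive_le_sqr HC.
Qed.

Lemma preserves_smooth_flat n p : @preserves_smooth R n (flat p).
Proof.
pose p_ j := iter j (fun q : {poly R} => 'X^2 * (q - q^`())) p.
by move=> F; apply: (@smooth_comp_seq _ _ (fun j => flat (p_ j))) => j x; exact: is_derive_flat.
Qed.

Lemma flat_le0 p x : x <= 0 -> flat p x = 0.
Proof. by move=> x0; rewrite /flat ltNge x0. Qed.

Lemma flat1_gt0 x : 0 < x -> 0 < flat 1 x.
Proof. by move=> x0; rewrite /flat x0 hornerC mul1r expR_gt0. Qed.

Lemma flat1_ge0 x : 0 <= flat 1 x.
Proof. by rewrite /flat; case: ifP => // _; rewrite hornerC mul1r expR_ge0. Qed.

Lemma flat1_le x y : x <= y -> flat 1 x <= flat 1 y.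
Proof.
move=> xy; have [x0|x0] := leP x 0; first by rewrite flat_le0// flat1_ge0.
have y0 := lt_le_trans x0 xy.
by rewrite /flat x0 y0 !hornerC !mul1r ler_expR lerN2 lef_pV2.
Qed.

Lemma is_derive_affine (a b x : R) : is_derive x (1 : R) (fun y => a * y + b) a.
Proof.
have := is_deriveD (is_deriveZ a (is_derive_id x (1 : R))) (is_derive_cst b x (1 : R)).
by move/is_derive_eq; apply; rewrite addr0 /GRing.scale /= mulr1.
Qed.

(** Up to a factor, [chi] is flat(flat(1) - flat(u)) with u affine, u(a) = 0 and u(b) = 1: the inner
    flat function gives the plateau, the outer one the zeros, without a quotient of functions. The
    derivative is recorded because it occurs in the speed of the flow and has to vanish on the
    plateau, endpoint included. *)
Lemma smooth_cutoff (a b : R) : a < b -> exists chi chi' : R -> R,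
  [/\ forall n, @preserves_smooth R n chi,
      forall x, is_derive x (1 : R) chi (chi' x),
      forall x, x <= a -> chi x = 1 /\ chi' x = 0,
      forall x, b <= x -> chi x = 0 &
      forall x, 0 <= chi x <= 1].
Proof.
move=> ab; have ba : 0 < b - a by rewrite subr_gt0.
pose u x := (b - a)^-1 * x + - ((b - a)^-1 * a).
pose e1 : R := flat 1 1; pose q : {poly R} := 'X^2 * (1 - 1^`()).
pose k := flat 1 e1; have k0 : 0 < k by apply: flat1_gt0; exact: flat1_gt0.
pose w x := -1 * flat 1 (u x) + e1.
exists (fun x => k^-1 * flat 1 (w x) + 0).
exists (fun x => - (k^-1 * flat q (w x) * flat q (u x) * (b - a)^-1)).
have uE x : u x = (x - a) / (b - a) by rewrite /u; field; rewrite gt_eqF.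
split.
- move=> n; apply: (preserves_smooth_comp (g := fun y => k^-1 * y + 0) (h := flat 1 \o w)).
    exact: preserves_smooth_affine.
  apply: preserves_smooth_comp; first exact: preserves_smooth_flat.
  apply: (preserves_smooth_comp (g := fun y => -1 * y + e1) (h := flat 1 \o u)).
    exact: preserves_smooth_affine.
  apply: preserves_smooth_comp; first exact: preserves_smooth_flat.
  exact: preserves_smooth_affine.
- move=> x.
  have du : is_derive x (1 : R) u (b - a)^-1.
    exact: is_derive_affine.
  have dfu : is_derive x (1 : R) (flat 1 \o u) ((b - a)^-1 * flat q (u x)).
    rewrite mulrC; exact: (is_derive1_comp (is_derive_flat 1 (u x)) du).
  have dw : is_derive x (1 : R) w (- ((b - a)^-1 * flat q (u x))).
    have := is_deriveD (is_deriveZ (-1) dfu) (is_derive_cst e1 x (1 : R)).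
    by rewrite addr0 scaleN1r.
  have dfw : is_derive x (1 : R) (flat 1 \o w) (- ((b - a)^-1 * flat q (u x)) * flat q (w x)).
    rewrite mulrC; exact: (is_derive1_comp (is_derive_flat 1 (w x)) dw).
  have := is_deriveD (is_deriveZ k^-1 dfw) (is_derive_cst (0 : R) x (1 : R)).
  by move=> /is_derive_eq; apply; rewrite addr0 /GRing.scale /=; ring.
- move=> x xa; have ux : u x <= 0.
    by rewrite uE pmulr_lle0 ?invr_gt0// subr_le0.
  rewrite /w !(flat_le0 _ ux) mulr0 add0r mulVf ?gt_eqF// addr0; split=> //.
  by rewrite mulr0 mul0r oppr0.
- move=> x bx; rewrite [flat 1 (w x)]flat_le0 ?mulr0 ?addr0//.
  rewrite /w mulN1r addrC subr_le0; apply: flat1_le.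
  by rewrite uE ler_pdivlMr// mul1r lerD2r.
- move=> x; rewrite addr0 mulr_ge0 ?invr_ge0 ?(ltW k0) ?flat1_ge0//=.
  rewrite mulrC ler_pdivrMr// mul1r; apply: flat1_le.
  by rewrite /w mulN1r gerDr oppr_le0 flat1_ge0.
Qed.

End Cutoff.

(** * Sine bounds and the Lebesgue measure of the plane *)

Section SineBounds.
Context {R : realType}.

Lemma sin_ge_linear (t : R) : `|t| <= 1 -> cos 1 * `|t| <= `|sin t|.
Proof.
wlog t0 : t / 0 <= t.
  move=> H; have [/H//|/ltW t0] := leP 0 t.
  by rewrite -(normrN t) -(normrN (sin t)) -sinN; apply: H; rewrite ?normrN// oppr_ge0.
rewrite (ger0_norm t0) => t1; rewrite (le_trans _ (ler_norm _))//.
move: t0; rewrite le_eqVlt => /predU1P[<-|t0]; first by rewrite mulr0 sin0.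
have [c /itvP c0t] := @MVT R (@sin R) (@cos R) 0 t t0 (fun x _ => is_derive_sin x)
  (continuous_subspaceT (@continuous_sin R)).
- rewrite sin0 !subr0 => ->; rewrite ler_pM2r//.
  have [->//|c1] := eqVneq c 1.
  have c_lt1 : c < 1 by rewrite (lt_le_trans _ t1)// c0t.
  have pi1 : 1 <= pi :> R by rewrite (le_trans _ (@pi_ge2 R))// ler1n.
  by rewrite ltW// ltr_cos ?in_itv/= ?c0t ?ler01 ?pi1//= ltW// (lt_le_trans c_lt1).
Qed.

Lemma cosB_cos (x y : R) :
  cos x - cos y = - (2 * (sin ((x + y) / 2) * sin ((x - y) / 2))).
Proof.
have ex : (x + y) / 2 + (x - y) / 2 = x by field.
have ey : (x + y) / 2 - (x - y) / 2 = y by field.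
by have := cosD ((x + y) / 2) ((x - y) / 2); have := cosB ((x + y) / 2) ((x - y) / 2); rewrite ex ey => -> ->; ring.
Qed.

(* If cos is nearly the same at three separated points, then sin nearly
   vanishes at two distinct midpoints, although these are close together. *)
Lemma cos_three_points (x1 x2 x3 h eta : R) : 0 < h ->
  h <= `|x1 - x2| <= 1 -> h <= `|x2 - x3| <= 1 -> h <= `|x1 - x3| <= 1 ->
  `|cos x1 - cos x2| <= eta -> `|cos x2 - cos x3| <= eta ->
  cos 1 ^+ 2 * h ^+ 2 <= 4 * eta.
Proof.
move=> h0; have c0 := @cos1_gt0 R.
have half (x y : R) : h <= `|x - y| <= 1 -> cos 1 * h <= 2 * `|sin ((x - y) / 2)|.
  move=> /andP[hxy xy1].
  have n2 : `|(x - y) / 2| = `|x - y| / 2 by rewrite normrM normfV (ger0_norm (_ : 0 <= 2)).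
  have := @sin_ge_linear ((x - y) / 2); rewrite n2.
  have /[swap] /[apply] H : `|x - y| / 2 <= 1 by lra.
  have : cos 1 * h <= cos 1 * `|x - y| by rewrite ler_pM2l.
  by move: H; rewrite mulrA; lra.
have mid (x y : R) : h <= `|x - y| <= 1 -> `|cos x - cos y| <= eta ->
    cos 1 * h * `|sin ((x + y) / 2)| <= eta.
  move=> /half H; rewrite cosB_cos normrN !normrM (ger0_norm (_ : 0 <= 2))//.
  apply: le_trans; rewrite mulrCA mulrC ler_wpM2l//.
move=> h12 h23 h13 /(mid _ _ h12) m12 /(mid _ _ h23) m23.
have {}h13 := half _ _ h13.
have e13 : (x1 - x3) / 2 = (x1 + x2) / 2 - (x2 + x3) / 2 by field.
rewrite e13 in h13.
set u := (x1 + x2) / 2 in m12 h13; set v := (x2 + x3) / 2 in m23 h13.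
have suv : `|sin (u - v)| <= `|sin u| + `|sin v|.
  rewrite sinB (le_trans (ler_normB _ _))// !normrM.
  by rewrite lerD// ?ler_piMr ?ler_piMl ?cos_max.
have ch0 : 0 < cos 1 * h by rewrite mulr_gt0.
have : cos 1 * h * (cos 1 * h) <= cos 1 * h * (2 * (`|sin u| + `|sin v|)).
  by rewrite ler_pM2l//; lra.
by rewrite !expr2; lra.
Qed.

End SineBounds.

Section PlaneMeasure.
Context {R : realType}.
Notation mu := (@lebesgue_measure R).
Notation RR := (measurableTypeR R * measurableTypeR R)%type.
Local Open Scope ereal_scope.

(** True without measurability, because the sections are measured by an outer measure and the
    integral is a supremum over simple functions lying below. A hull can thus be compared directly
    with a measurable set containing it. *)
Lemma le_lebesgue2 (A B : set (R * R)) : A `<=` B -> lebesgue2 A <= lebesgue2 B.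
Proof.
move=> AB; rewrite /lebesgue2 /= /product_measure1.
have le1 x : mu (xsection A x) <= mu (xsection B x).
  by apply: le_mu_ext => y; rewrite /xsection /= !inE; exact: AB.
rewrite !ge0_integralTE; [|by move=> x; exact: measure_ge0..].
apply: le_ereal_sup => _ [h hA <-]; exists h => // x.
exact: le_trans (hA x) (le1 x).
Qed.

Lemma outer_lebesgue2_le (A B : set (R * R)) :
  A `<=` B -> measurable (B : set RR) -> outer_lebesgue2 A <= lebesgue2 B.
Proof.
by move=> AB mB; rewrite -(measurable_mu_extE lebesgue2 mB); exact: le_mu_ext.
Qed.

Lemma lebesgue_measureD (c : R) (A : set R) : measurable (A : set (measurableTypeR R)) ->
  mu ((fun y => y + c)%R @^-1` A) = mu A.
Proof.
move=> mA.
have mc : measurable_fun [set: measurableTypeR R] (fun y : measurableTypeR R => y + c : measurableTypeR R)%R.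
  exact: measurable_funD.
pose f : {mfun measurableTypeR R >-> measurableTypeR R} :=
  HB.pack (fun y : measurableTypeR R => y + c : measurableTypeR R)%R
    (isMeasurableFun.Build _ _ _ _ _ mc).
apply/esym/(@lebesgue_measure_unique R (pushforward mu f) _ A mA) => _ [[a b]] _ <-.
transitivity (mu `]a - c, b - c]%classic%R); last first.
  by congr mu; apply/seteqP; split => y /=; rewrite !in_itv /= ltrBlDr lerBrDr.
rewrite !lebesgue_measure_itv /= !lte_fin ltrD2r; case: ifP => // _.
by rewrite -!EFinB; congr (_%:E); ring.
Qed.

Lemma lebesgue2_vshear (g : R -> R) (A : set (R * R)) :
  measurable_fun [set: measurableTypeR R] (g : measurableTypeR R -> measurableTypeR R) ->
  measurable (A : set RR) ->
  lebesgue2 ((fun w => (w.1, w.2 + g w.1)%R) @^-1` A) = lebesgue2 A.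
Proof.
move=> mg mA; rewrite /lebesgue2 /= /product_measure1.
apply: eq_integral => x _ /=.
rewrite -[RHS](@lebesgue_measureD (g x)); last exact: measurable_xsection.
by congr mu; apply/seteqP; split => y; rewrite /xsection /= !inE.
Qed.

Lemma lebesgue2_hshear (g : R -> R) (A : set (R * R)) :
  measurable_fun [set: measurableTypeR R] (g : measurableTypeR R -> measurableTypeR R) ->
  measurable (A : set RR) ->
  lebesgue2 ((fun w => (w.1 + g w.2, w.2)%R) @^-1` A) = lebesgue2 A.
Proof.
move=> mg mA.
have mB : measurable ((fun w => (w.1 + g w.2, w.2)%R) @^-1` A : set RR).
  rewrite -[X in measurable X]setTI; apply: (_ : measurable_fun setT _) => //.
  apply/measurable_fun_pairP; split => /=; last exact: measurable_snd.
  apply: measurable_funD; first exact: measurable_fst.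
  exact: (measurableT_comp mg measurable_snd).
(* Integrated in the other order, a horizontal shear translates each horizontal section; uniqueness
   of the product measure identifies the two orders on measurable sets. *)
have sw (B : set RR) : measurable B -> lebesgue2 B = (mu \x^ mu) B.
  by move=> mB'; apply: product_measure_unique => // C D mC mD; exact: product_measure2E.
rewrite !sw// /product_measure2.
apply: eq_integral => y _ /=.
rewrite -[RHS](@lebesgue_measureD (g y)); last exact: measurable_ysection.
by congr mu; apply/seteqP; split => x; rewrite /ysection /= !inE.
Qed.

Lemma lebesgue2_box (a b c d : R) : (a <= b)%R -> (c <= d)%R ->
  lebesgue2 (`[a, b]%classic `*` `[c, d]%classic) = ((b - a) * (d - c))%:E.
Proof.
move=> ab cd; rewrite /lebesgue2 /= product_measure1E//= !lebesgue_measure_itv /= !lte_fin.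
move: ab; rewrite le_eqVlt => /predU1P[->|ab]; first by rewrite ltxx subrr mul0r mul0e.
move: cd; rewrite le_eqVlt => /predU1P[->|cd]; first by rewrite ltxx subrr mulr0 mule0.
by rewrite ab cd EFinM !EFinB.
Qed.

End PlaneMeasure.

(** * Plane Hamiltonians with explicit flows *)

Section CurveDerivatives.
Context {R : realType}.
Implicit Types (f g F : R -> R) (t a b : R).

Lemma is_derive_val f t a b : is_derive t (1 : R) f a -> a = b -> is_derive t (1 : R) f b.
Proof. by move=> ? <-. Qed.

Lemma curveD f g t a b : is_derive t (1 : R) f a -> is_derive t (1 : R) g b ->
  is_derive t (1 : R) (fun s => f s + g s) (a + b).
Proof. by move=> df dg; exact: is_deriveD. Qed.

Lemma curveN f t a : is_derive t (1 : R) f a -> is_derive t (1 : R) (fun s => - f s) (- a).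
Proof. by move=> df; exact: is_deriveN. Qed.

Lemma curveM f g t a b : is_derive t (1 : R) f a -> is_derive t (1 : R) g b ->
  is_derive t (1 : R) (fun s => f s * g s) (a * g t + f t * b).
Proof.
move=> df dg; have := is_deriveM df dg; move/is_derive_eq; apply.
by rewrite addrC; congr (_ + _); exact: mulrC.
Qed.

Lemma curve_cst t c : is_derive t (1 : R) (fun=> c : R) 0.
Proof. exact: is_derive_cst. Qed.

Lemma curve_comp F (F' : R -> R) g t b : (forall x, is_derive x (1 : R) F (F' x)) ->
  is_derive t (1 : R) g b -> is_derive t (1 : R) (fun s => F (g s)) (F' (g t) * b).
Proof. by move=> dF dg; exact: (@is_derive1_comp _ F g t _ _ (dF _) dg). Qed.

Lemma curve_sqr f t a : is_derive t (1 : R) f a ->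
  is_derive t (1 : R) (fun s => f s ^+ 2) (2 * f t * a).
Proof.
move=> df; rewrite (_ : (fun s => _) = fun s => f s * f s); last by apply/funext => s; rewrite expr2.
by apply: (is_derive_val (curveM df df)); ring.
Qed.

Lemma curve_cos f t a : is_derive t (1 : R) f a ->
  is_derive t (1 : R) (fun s => cos (f s)) (- sin (f t) * a).
Proof. by apply: curve_comp => x; exact: is_derive_cos. Qed.

Lemma curve_sin f t a : is_derive t (1 : R) f a ->
  is_derive t (1 : R) (fun s => sin (f s)) (cos (f t) * a).
Proof. by apply: curve_comp => x; exact: is_derive_sin. Qed.

End CurveDerivatives.

Section PlaneHamiltonians.
Context {R : realType}.
Implicit Types (w u : R * R) (t : R) (k kx ky : R * R -> R) (P : R -> R * R -> R * R).

(** The partial derivatives are specified by the chain rule along curves, the form in which the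
    differential of H will be computed. The signs in the flow equations are those of [omega0]. *)
Record plane_hamiltonian k kx ky P : Prop := PlaneHamiltonian {
  plane_smooth : forall n (l : 'I_n), smooth (fun z : phase_space R n => k (z l 0, z l 1));
  plane_chain : forall (x y : R -> R) t a b,
    is_derive t (1 : R) x a -> is_derive t (1 : R) y b ->
    is_derive t (1 : R) (fun s => k (x s, y s)) (kx (x t, y t) * a + ky (x t, y t) * b);
  plane_flow0 : forall w, P 0 w = w;
  plane_flow_fst : forall w t, is_derive t (1 : R) (fun s => (P s w).1) (ky (P t w));
  plane_flow_snd : forall w t, is_derive t (1 : R) (fun s => (P s w).2) (- kx (P t w));
  plane_conserved : forall w t, k (P t w) = k w }.

(** Clockwise, the sense in which the Hamiltonian flow of the squared radius turns, with angular
    speed 2. *)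
Definition rot t w : R * R := (cos t * w.1 + sin t * w.2, - sin t * w.1 + cos t * w.2).
Definition shiftx (m : R) w : R * R := (w.1 + m, w.2).
Definition sqn w : R := w.1 ^+ 2 + w.2 ^+ 2.

Lemma rotD s t w : rot s (rot t w) = rot (s + t) w.
Proof. by rewrite /rot sinD cosD /=; congr pair; ring. Qed.

Lemma rot0 w : rot 0 w = w.
Proof. by case: w => x y; rewrite /rot sin0 cos0 /=; congr pair; ring. Qed.

Lemma rotK t : cancel (rot t) (rot (- t)).
Proof. by move=> w; rewrite rotD addNr rot0. Qed.

Lemma sqn_rot t w : sqn (rot t w) = sqn w.
Proof.
rewrite /sqn /rot /=.
transitivity ((cos t ^+ 2 + sin t ^+ 2) * (w.1 ^+ 2 + w.2 ^+ 2)); first by ring.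
by rewrite cos2Dsin2 mul1r.
Qed.

Lemma sqn_ge0 w : 0 <= sqn w.
Proof. by rewrite addr_ge0// sqr_ge0. Qed.

Lemma shiftxK m : cancel (shiftx m) (shiftx (- m)).
Proof. by case=> x y; rewrite /shiftx /= addrK. Qed.

Lemma shiftxNK m : cancel (shiftx (- m)) (shiftx m).
Proof. by case=> x y; rewrite /shiftx /= subrK. Qed.

Lemma rot_curve (x y : R -> R) (th : R -> R) t a b d :
  is_derive t (1 : R) x a -> is_derive t (1 : R) y b -> is_derive t (1 : R) th d ->
  is_derive t (1 : R) (fun s => (rot (th s) (x s, y s)).1)
    ((rot (th t) (a, b)).1 + d * (rot (th t) (x t, y t)).2) /\
  is_derive t (1 : R) (fun s => (rot (th s) (x s, y s)).2)
    ((rot (th t) (a, b)).2 - d * (rot (th t) (x t, y t)).1).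
Proof.
move=> dx dy dth; have dc := curve_cos dth; have ds := curve_sin dth; split.
  by apply: (is_derive_val (curveD (curveM dc dx) (curveM ds dy))); rewrite /rot /=; ring.
by apply: (is_derive_val (curveD (curveM (curveN ds) dx) (curveM dc dy))); rewrite /rot /=; ring.
Qed.

Lemma smooth_coord_affine n (l : 'I_n) (j : 'I_2) (c : R) :
  smooth (fun z : phase_space R n => z l j + c).
Proof. by apply: smoothD; [exact: smooth_coord|exact: smooth_cst]. Qed.

Lemma smooth_sqn n (l : 'I_n) (m : R) :
  smooth (fun z : phase_space R n => sqn (shiftx m (z l 0, z l 1))).
Proof.
apply: smoothD; rewrite /shiftx /=.
  rewrite (_ : (fun z => _) = (fun z : phase_space R n => z l 0 + m) \* (fun z => z l 0 + m)).
    by apply: smoothM; exact: smooth_coord_affine.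
  by apply/funext => z; rewrite /= expr2.
rewrite (_ : (fun z => _) = (fun z : phase_space R n => z l 1) \* (fun z => z l 1)).
  by apply: smoothM; exact: smooth_coord.
by apply/funext => z; rewrite /= expr2.
Qed.

Lemma rot_hamiltonian (c : R) : plane_hamiltonian
  (fun w => sqn (shiftx (- c) w)) (fun w => 2 * (w.1 - c)) (fun w => 2 * w.2)
  (fun t w => shiftx c (rot (2 * t) (shiftx (- c) w))).
Proof.
have d2 t : is_derive t (1 : R) (fun s => 2 * s) 2.
  have := is_derive_affine 2 0 t.
  by rewrite (_ : (fun y => _) = (fun s => 2 * s))//; apply/funext => s; rewrite addr0.
have dr w t := rot_curve (curve_cst t (w.1 - c)) (curve_cst t w.2) (d2 t).
split.
- by move=> n l; exact: smooth_sqn.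
- move=> x y t a b dx dy; apply: (is_derive_val (curveD (curve_sqr (curveD dx (curve_cst t (- c)))) (curve_sqr dy))).
  by rewrite /= addr0.
- by move=> w; rewrite mulr0 rot0 shiftxNK.
- move=> w t; apply: (is_derive_val (curveD (dr w t).1 (curve_cst t c))).
  by rewrite /= !mulr0 !addr0 add0r.
- move=> w t; apply: (is_derive_val (dr w t).2).
  by rewrite /= !mulr0 add0r; ring.
- by move=> w t; rewrite shiftxK sqn_rot.
Qed.

Lemma zero_hamiltonian : plane_hamiltonian (fun=> 0) (fun=> 0) (fun=> 0) (fun _ w => w).
Proof.
split=> //.
- by move=> n l; exact: smooth_cst.
- by move=> x y t a b _ _; rewrite !mul0r addr0; exact: curve_cst.
- by move=> w t; exact: curve_cst.
- by move=> w t; rewrite oppr0; exact: curve_cst.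
Qed.

Lemma fst_translation_hamiltonian :
  plane_hamiltonian (fun w => w.2) (fun=> 0) (fun=> 1) (fun t w => (w.1 + t, w.2)).
Proof.
split=> //=.
- by move=> n l; exact: smooth_coord.
- by move=> x y t a b _ dy; rewrite mul0r add0r mul1r.
- by case=> x y; rewrite addr0.
- move=> w t; rewrite -[X in is_derive _ _ _ X]add0r.
  exact: (curveD (curve_cst t w.1) (is_derive_id t (1 : R))).
- by move=> w t; rewrite oppr0; exact: curve_cst.
Qed.

Lemma snd_translation_hamiltonian :
  plane_hamiltonian (fun w => - w.1) (fun=> -1) (fun=> 0) (fun t w => (w.1, w.2 + t)).
Proof.
split=> //=.
- move=> n l; rewrite (_ : (fun z => _) = (fun x => -1 * x + 0) \o (fun z : phase_space R n => z l 0)).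
    exact: (preserves_smooth_affine _ _ (smooth_coord _ _)).
  by apply/funext => z /=; rewrite addr0 mulN1r.
- by move=> x y t a b dx _; rewrite mul0r addr0 mulN1r; exact: curveN.
- by case=> x y; rewrite addr0.
- by move=> w t; exact: curve_cst.
- move=> w t; rewrite opprK -[X in is_derive _ _ _ X]add0r.
  exact: (curveD (curve_cst t w.2) (is_derive_id t (1 : R))).
Qed.

End PlaneHamiltonians.

(** * The squared radius conjugated by a twist *)

Section TwistedDisc.
Context {R : realType}.
Variables (m : R) (f f' : R -> R).
Hypothesis f_smooth : forall n, @preserves_smooth R n f.
Hypothesis f_derive : forall q, is_derive q (1 : R) f (f' q).
Implicit Types (w v : R * R) (t : R).

(** Each circle about (m, 0) is turned by an angle depending on its radius. Once f(m^2) = pi, the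
    origin and (2m, 0), both at distance m from the centre, are exchanged. *)
Definition untwist w := let u := shiftx (- m) w in shiftx m (rot (f (sqn u)) u).
Definition twist v := let u := shiftx (- m) v in shiftx m (rot (- f (sqn u)) u).
Definition twisted_sqn w := sqn (untwist w).
Definition twisted_flow t w := twist (rot (2 * t) (untwist w)).

(** [twisted_dx] and [twisted_dy] are the partial derivatives of the expression in
    [twisted_sqnE]. *)
Definition twisted_dx w := let X := w.1 - m in let q := X ^+ 2 + w.2 ^+ 2 in
  2 * X + 2 * m * (cos (f q) + f' q * 2 * X * (- sin (f q) * X + cos (f q) * w.2)).
Definition twisted_dy w := let X := w.1 - m in let q := X ^+ 2 + w.2 ^+ 2 in
  2 * w.2 + 2 * m * (sin (f q) + f' q * 2 * w.2 * (- sin (f q) * X + cos (f q) * w.2)).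

Lemma untwistK : cancel untwist twist.
Proof. by move=> w; rewrite /twist /untwist shiftxK sqn_rot rotK shiftxNK. Qed.

Lemma twistK : cancel twist untwist.
Proof.
by move=> w; rewrite /twist /untwist shiftxK sqn_rot rotD subrr rot0 shiftxNK.
Qed.

Lemma twisted_sqnE w : twisted_sqn w = m ^+ 2 + sqn (shiftx (- m) w) +
  2 * m * (rot (f (sqn (shiftx (- m) w))) (shiftx (- m) w)).1.
Proof.
rewrite /twisted_sqn /untwist; set u := shiftx (- m) w.
set th := f (sqn u); rewrite -(sqn_rot th u).
by rewrite /sqn /shiftx /=; ring.
Qed.

Lemma twisted_flowD s t w : twisted_flow s (twisted_flow t w) = twisted_flow (s + t) w.
Proof. by rewrite /twisted_flow twistK rotD mulrDr. Qed.

Let d2 t : is_derive t (1 : R) (fun s => 2 * s) 2.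
Proof.
have := is_derive_affine 2 0 t.
by rewrite (_ : (fun y => _) = (fun s => 2 * s))//; apply/funext => s; rewrite addr0.
Qed.

Lemma twisted_flow_curve w t :
  let v s := shiftx (- m) (rot (2 * s) (untwist w)) in
  let th := - f (sqn (v t)) in
  let dth := f' (sqn (v t)) * (4 * m * (v t).2) in
  let dv := (2 * (v t).2, - 2 * ((v t).1 + m)) in
  is_derive t (1 : R) (fun s => (rot (- f (sqn (v s))) (v s)).1)
    ((rot th dv).1 + dth * (rot th (v t)).2) /\
  is_derive t (1 : R) (fun s => (rot (- f (sqn (v s))) (v s)).2)
    ((rot th dv).2 - dth * (rot th (v t)).1).
Proof.
move=> v th dth dv.
have [e1 e2] := rot_curve (curve_cst t (untwist w).1) (curve_cst t (untwist w).2) (d2 t).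
have d1 : is_derive t (1 : R) (fun s => (v s).1) dv.1.
  apply: (is_derive_val (curveD e1 (curve_cst t (- m)))).
  by rewrite /dv /v /rot /shiftx /=; ring.
have {}e2 : is_derive t (1 : R) (fun s => (v s).2) dv.2.
  by apply: (is_derive_val e2); rewrite /dv /v /rot /shiftx /=; ring.
have dq := curveD (curve_sqr d1) (curve_sqr e2).
have -> : dth = - (f' (sqn (v t)) * (2 * (v t).1 * dv.1 + 2 * (v t).2 * dv.2)).
  by rewrite /dth /dv /=; ring.
exact: (rot_curve d1 e2 (curveN (curve_comp f_derive dq))).
Qed.

(** The left-hand sides are the velocities found in [twisted_flow_curve]. This is the invariance of
    Hamilton's equations under the area preserving map [twist], checked by computation. *)
Lemma twisted_field (z : R * R) :
  let v := shiftx (- m) z in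
  let th := - f (sqn v) in
  let dth := f' (sqn v) * (4 * m * v.2) in
  let dv := (2 * v.2, - 2 * (v.1 + m)) in
  ((rot th dv).1 + dth * (rot th v).2 = twisted_dy (twist z)) /\
  ((rot th dv).2 - dth * (rot th v).1 = - twisted_dx (twist z)).
Proof.
move=> v th dth dv; rewrite /twisted_dx /twisted_dy.
set u := rot th v; have tE : twist z = shiftx m u by [].
have -> : (twist z).1 - m = u.1 by rewrite tE /= addrK.
have -> : (twist z).2 = u.2 by [].
have -> : u.1 ^+ 2 + u.2 ^+ 2 = sqn v by rewrite -(sqn_rot th v).
(* This combination is the second coordinate of [u] rotated back, that is of [v]. *)
have -> : - sin (f (sqn v)) * u.1 + cos (f (sqn v)) * u.2 = v.2.
  transitivity (rot (- th) u).2; first by rewrite /th opprK.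
  by rewrite /u rotK.
by rewrite /dth /dv /u /th /rot /= cosN sinN; split; ring.
Qed.

Lemma twisted_hamiltonian :
  plane_hamiltonian twisted_sqn twisted_dx twisted_dy twisted_flow.
Proof.
split.
- move=> n l.
  pose S (z : phase_space R n) := sqn (shiftx (- m) (z l 0, z l 1)).
  have sS : smooth S by exact: smooth_sqn.
  rewrite (_ : (fun z => _) = (fun z : phase_space R n => m ^+ 2 + S z +
      2 * m * (cos (f (S z)) * (z l 0 - m) + sin (f (S z)) * z l 1))); last first.
    by apply/funext => z; rewrite twisted_sqnE.
  apply: smoothD; first by apply: smoothD => //; exact: smooth_cst.
  apply: smoothM; first exact: smooth_cst.
  apply: smoothD; apply: smoothM.
  + by apply: (preserves_smooth_cos (F := f \o S)); exact: f_smooth.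
  + exact: smooth_coord_affine.
  + by apply: (preserves_smooth_sin (F := f \o S)); exact: f_smooth.
  + exact: smooth_coord.
- move=> x y t a b dx dy.
  rewrite (_ : (fun s => _) = (fun s => m ^+ 2 + ((x s - m) ^+ 2 + y s ^+ 2) +
    2 * m * (rot (f ((x s - m) ^+ 2 + y s ^+ 2)) (x s - m, y s)).1)); last first.
    by apply/funext => s; rewrite twisted_sqnE.
  have dX : is_derive t (1 : R) (fun s => x s - m) a.
    by apply: (is_derive_val (curveD dx (curve_cst t (- m)))); rewrite addr0.
  have dq := curveD (curve_sqr dX) (curve_sqr dy).
  have dr := (rot_curve dX dy (curve_comp f_derive dq)).1.
  apply: (is_derive_val (curveD (curveD (curve_cst t (m ^+ 2)) dq) (curveM (curve_cst t (2 * m)) dr))).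
  by rewrite /twisted_dx /twisted_dy /rot /=; ring.
- by move=> w; rewrite /twisted_flow mulr0 rot0 untwistK.
- move=> w t; have [d1 _] := twisted_flow_curve w t.
  apply: (is_derive_val (curveD d1 (curve_cst t m))); rewrite addr0.
  exact: (twisted_field (rot (2 * t) (untwist w))).1.
- move=> w t; have [_ d1] := twisted_flow_curve w t.
  apply: (is_derive_val d1).
  exact: (twisted_field (rot (2 * t) (untwist w))).2.
- by move=> w t; rewrite /twisted_sqn twistK sqn_rot.
Qed.

End TwistedDisc.

Section TwistedLevels.
Context {R : realType}.
Variables (m R0 : R) (f f' : R -> R).
Hypotheses (m_gt0 : 0 < m) (mR0 : m < R0).
Hypothesis f_derive : forall q, is_derive q (1 : R) f (f' q).
Hypothesis f_pi : f (m ^+ 2) = pi.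
Hypothesis f_out : forall q, R0 ^+ 2 <= q -> f q = 0.
Implicit Types (w v u : R * R) (t r : R).

Notation K := (twisted_sqn m f).

Lemma norm_le_sqr (x r : R) : 0 <= r -> x ^+ 2 <= r ^+ 2 -> `|x| <= r.
Proof. by move=> r0 xr; rewrite -sqrtr_sqr -(ger0_norm r0) -sqrtr_sqr ler_wsqrtr. Qed.

Lemma polar u : exists th, u = (Num.sqrt (sqn u) * cos th, Num.sqrt (sqn u) * sin th).
Proof.
case: u => x y; set rho := Num.sqrt _.
have rho2 : rho ^+ 2 = x ^+ 2 + y ^+ 2 by rewrite sqr_sqrtr// sqn_ge0.
have [r0|rn0] := eqVneq rho 0.
  exists 0; rewrite r0 !mul0r.
  by move: rho2; rewrite r0 expr0n => /esym/eqP; rewrite paddr_eq0 ?sqr_ge0// !sqrf_eq0 => /andP[/eqP-> /eqP->].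
have r_gt0 : 0 < rho by rewrite lt_def rn0 sqrtr_ge0.
have x1 : -1 <= x / rho <= 1.
  rewrite -ler_norml normrM normfV (gtr0_norm r_gt0) ler_pdivrMr// mul1r.
  by apply: norm_le_sqr; [exact: ltW|rewrite rho2 lerDl sqr_ge0].
have s2 : rho * Num.sqrt (1 - (x / rho) ^+ 2) = `|y|.
  rewrite -{1}(gtr0_norm r_gt0) -sqrtr_sqr -sqrtrM ?sqr_ge0// -sqrtr_sqr; congr Num.sqrt.
  by rewrite mulrBr mulr1 -exprMn mulrCA divff// mulr1 rho2; ring.
have cK : rho * cos (acos (x / rho)) = x.
  by rewrite acosK ?in_itv//= mulrCA divff// mulr1.
have [y0|y0] := leP 0 y.
  by exists (acos (x / rho)); rewrite cK sin_acos// s2 ger0_norm.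
exists (- acos (x / rho)); rewrite cosN sinN cK mulrN sin_acos// s2 ltr0_norm//.
by rewrite opprK.
Qed.

(** A half turn about (m, 0) carries (2m, 0) to the origin: the displaced centre of the level curves
    is (2m, 0). *)
Lemma twisted_sqn_center : K (2 * m, 0) = 0.
Proof.
have E : shiftx (- m) (2 * m, 0) = (m, 0) by rewrite /shiftx /=; congr pair; ring.
rewrite twisted_sqnE E /sqn /rot /= expr0n addr0 f_pi cospi sinpi; ring.
Qed.

Lemma twisted_sqn_out w : R0 ^+ 2 <= sqn (shiftx (- m) w) -> K w = sqn w.
Proof. by move=> /f_out e; rewrite /twisted_sqn /untwist e rot0 shiftxNK. Qed.

Lemma sqn_shiftx_le u : sqn u <= R0 ^+ 2 -> sqn (shiftx m u) <= (m + R0) ^+ 2.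
Proof.
have R0_gt0 := lt_trans m_gt0 mR0.
rewrite /sqn /shiftx /= => u2.
have : u.1 <= R0.
  by rewrite (le_trans (ler_norm _))// norm_le_sqr ?(ltW R0_gt0)// (le_trans _ u2)// lerDl sqr_ge0.
by rewrite -(ler_pM2l m_gt0) => H; rewrite sqrrD [leRHS]sqrrD; nra.
Qed.

(** The twist moves only points of the disc of radius R0 about (m, 0). It preserves this disc, which
    lies in the disc of radius m + R0 about the origin, so larger discs about the origin are
    sublevel sets of both functions. *)
Lemma twisted_sqn_le w r : (m + R0) ^+ 2 <= r -> (K w <= r) = (sqn w <= r).
Proof.
move=> mr; have [/twisted_sqn_out->//|/ltW h] := leP (R0 ^+ 2) (sqn (shiftx (- m) w)).
have -> : K w <= r.
  by rewrite (le_trans _ mr)// /twisted_sqn /untwist sqn_shiftx_le// sqn_rot.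
by rewrite (le_trans _ mr)// -(shiftxNK m w) sqn_shiftx_le.
Qed.

(** A level curve is the image of a circle under [twist], hence a single orbit. The time is half the
    difference of the polar angles because the flow turns by [2 * t]. *)
Lemma twisted_level w w' : K w = K w' -> exists t, twisted_flow m f t w = w'.
Proof.
rewrite /twisted_sqn /twisted_flow => e.
have [a ea] := polar (untwist m f w); have [b eb] := polar (untwist m f w').
exists ((a - b) / 2); rewrite -[RHS](untwistK m f); congr twist.
have -> : 2 * ((a - b) / 2) = a - b by field.
have bE : a - (a - b) = b by ring.
have := cosB a (a - b); have := sinB a (a - b); rewrite bE => sb cb.
by rewrite ea eb -e sb cb /rot /=; congr pair; ring.
Qed.

Section Continuity.
Context {T : topologicalType}.
Implicit Types (p : T -> R * R) (th : T -> R).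

Lemma continuous_pair (x y : T -> R) :
  continuous x -> continuous y -> continuous (fun s => (x s, y s)).
Proof. by move=> cx cy s; exact: (cvg_pair (cx s) (cy s)). Qed.

Lemma continuous_fst_comp p : continuous p -> continuous (fun s => (p s).1).
Proof. by move=> cp s; exact: (cvg_comp _ _ (cp s) cvg_fst). Qed.

Lemma continuous_snd_comp p : continuous p -> continuous (fun s => (p s).2).
Proof. by move=> cp s; exact: (cvg_comp _ _ (cp s) cvg_snd). Qed.

Lemma continuous_shiftx c p : continuous p -> continuous (fun s => shiftx c (p s)).
Proof.
move=> cp; apply: continuous_pair; last exact: continuous_snd_comp.
by move=> s; apply: cvgD; [exact: continuous_fst_comp|exact: cvg_cst].
Qed.

Lemma continuous_sqn p : continuous p -> continuous (fun s => sqn (p s)).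
Proof.
move=> cp s; rewrite /sqn; apply: cvgD.
  by apply: cvgM; exact: continuous_fst_comp.
by apply: cvgM; exact: continuous_snd_comp.
Qed.

Lemma continuous_rot th p : continuous th -> continuous p ->
  continuous (fun s => rot (th s) (p s)).
Proof.
move=> cth cp.
have c1 := continuous_fst_comp cp; have c2 := continuous_snd_comp cp.
have cc : continuous (fun s => cos (th s)).
  by move=> s; exact: (cvg_comp _ _ (cth s) (@continuous_cos R (th s))).
have cs : continuous (fun s => sin (th s)).
  by move=> s; exact: (cvg_comp _ _ (cth s) (@continuous_sin R (th s))).
apply: continuous_pair => s; apply: cvgD; apply: cvgM.
- exact: cc.
- exact: c1.
- exact: cs.
- exact: c2.
- by apply: cvgN; exact: cs.
- exact: c1.
- exact: cc.
- exact: c2.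
Qed.

Let f_cont : continuous f.
Proof.
by move=> q; apply/differentiable_continuous/derivable1_diffP; exact: ex_derive.
Qed.

Let continuous_f_sqn p : continuous p -> continuous (fun s => f (sqn (p s))).
Proof. by move=> /continuous_sqn cp s; apply: (cvg_comp _ _ (cp s)); exact: f_cont. Qed.

Lemma continuous_untwist p : continuous p -> continuous (fun s => untwist m f (p s)).
Proof.
move=> /(@continuous_shiftx (- m) _) cp.
by apply/continuous_shiftx/continuous_rot => //; exact: continuous_f_sqn.
Qed.

Lemma continuous_twist p : continuous p -> continuous (fun s => twist m f (p s)).
Proof.
move=> /(@continuous_shiftx (- m) _) cp.
apply/continuous_shiftx/continuous_rot => // s.
by apply: cvgN; exact: continuous_f_sqn.
Qed.

Lemma continuous_twisted_flow th p : continuous th -> continuous p ->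
  continuous (fun s => twisted_flow m f (th s) (p s)).
Proof.
move=> cth cp; apply/continuous_twist/continuous_rot; last exact: continuous_untwist.
by move=> s; apply: cvgM; [exact: cvg_cst|exact: cth].
Qed.

Lemma continuous_twisted_sqn p : continuous p -> continuous (fun s => K (p s)).
Proof. by move=> cp; apply/continuous_sqn/continuous_untwist. Qed.

End Continuity.
End TwistedLevels.

(** * Area of the level bands of the twisted radius *)

Section ThinSets.
Context {R : realType}.
Notation RR := (measurableTypeR R * measurableTypeR R)%type.
Notation mu2 := (@lebesgue2 R).

Definition rot_about (m al : R) (w : R * R) := shiftx m (rot al (shiftx (- m) w)).

(** A rotation is a product of three shears: a horizontal one of slope tan(al/2), a vertical one of
    slope - sin al, and the horizontal one again. Half turns, where the tangent has its pole, are
    excluded; the constant term in [h] places the centre at (m, 0). *)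
Lemma lebesgue2_rot_about (m al : R) (A : set (R * R)) : 1 + cos al != 0 ->
  measurable (A : set RR) -> mu2 (rot_about m al @^-1` A) = mu2 A.
Proof.
move=> c0 mA.
have alg (c s a : R) (w : R * R) : a * s = 1 - c -> a * (1 + c) = s ->
    shiftx m ((c * (w.1 - m) + s * w.2, - s * (w.1 - m) + c * w.2)) =
    (w.1 + a * w.2 + a * (w.2 + (- s * (w.1 + a * w.2) + s * m)),
     w.2 + (- s * (w.1 + a * w.2) + s * m)).
  case: w => x y /= as1 ac1; rewrite /shiftx /=; congr pair.
    transitivity (x - a * s * (x - m) + (2 * a - a * (a * s)) * y); last by ring.
    by rewrite as1 -ac1; ring.
  transitivity (y - s * (x - m) - a * s * y); last by ring.
  by rewrite as1; ring.
pose a := sin al / (1 + cos al).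
pose g (y : R) := a * y; pose h (x : R) := - sin al * x + sin al * m.
have mg : measurable_fun setT (g : measurableTypeR R -> measurableTypeR R).
  exact: mulrl_measurable.
have mh : measurable_fun setT (h : measurableTypeR R -> measurableTypeR R).
  apply: measurable_funD; first exact: mulrl_measurable.
  exact: measurable_cst.
pose S1 (w : R * R) := (w.1 + g w.2, w.2); pose S2 (w : R * R) := (w.1, w.2 + h w.1).
have mS1 (B : set RR) : measurable B -> measurable (S1 @^-1` B : set RR).
  move=> mB; rewrite -[X in measurable X]setTI; apply: (_ : measurable_fun setT _) => //.
  apply/measurable_fun_pairP; split => /=; last exact: measurable_snd.
  apply: measurable_funD; first exact: measurable_fst.
  exact: (measurableT_comp mg measurable_snd).
have mS2 (B : set RR) : measurable B -> measurable (S2 @^-1` B : set RR).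
  move=> mB; rewrite -[X in measurable X]setTI; apply: (_ : measurable_fun setT _) => //.
  apply/measurable_fun_pairP; split => /=; first exact: measurable_fst.
  apply: measurable_funD; first exact: measurable_snd.
  exact: (measurableT_comp mh measurable_fst).
have rotE w : rot_about m al w = S1 (S2 (S1 w)).
  have s2 : sin al ^+ 2 = (1 - cos al) * (1 + cos al) by rewrite sin2cos2; ring.
  have as1 : a * sin al = 1 - cos al.
    by rewrite /a mulrAC -expr2 s2 mulfK.
  have ac1 : a * (1 + cos al) = sin al by rewrite /a mulfVK.
  exact: alg.
have -> : rot_about m al @^-1` A = S1 @^-1` (S2 @^-1` (S1 @^-1` A)).
  by apply/seteqP; split => w; rewrite /preimage /mkset rotE.
have m1 := mS1 _ mA; have m2 := mS2 _ m1.
transitivity (mu2 (S2 @^-1` (S1 @^-1` A))); first exact: (lebesgue2_hshear mg m2).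
transitivity (mu2 (S1 @^-1` A)); first exact: (lebesgue2_vshear mh m1).
exact: (lebesgue2_hshear mg mA).
Qed.

Lemma measurable_rot_about (m al : R) (A : set (R * R)) :
  measurable (A : set RR) -> measurable (rot_about m al @^-1` A : set RR).
Proof.
move=> mA; rewrite -[X in measurable X]setTI; apply: (_ : measurable_fun setT _) => //.
have m1 : measurable_fun setT (fun w : RR => w.1 - m : R).
  by apply: measurable_funD; [exact: measurable_fst|exact: measurable_cst].
have m2 : measurable_fun setT (fun w : RR => w.2 : R) by exact: measurable_snd.
have mZ (c : R) (g : RR -> R) : measurable_fun setT g -> measurable_fun setT (fun w => c * g w).
  by move=> mg; apply: measurable_funM => //; exact: measurable_cst.
apply/measurable_fun_pairP; split.
  apply: measurable_funD; last exact: measurable_cst.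
  exact: (measurable_funD (mZ (cos al) _ m1) (mZ (sin al) _ m2)).
exact: (measurable_funD (mZ (- sin al) _ m1) (mZ (cos al) _ m2)).
Qed.

Variables (m : R) (f f' : R -> R).
Hypothesis m_gt0 : 0 < m.
Hypothesis f_derive : forall q, is_derive q (1 : R) f (f' q).
Notation K := (twisted_sqn m f).
Notation dist2 w := (sqn (shiftx (- m) w)).

(** The bounding disc is centred at (m, 0) to be invariant under the rotations about this point;
    radius 2 is enough to contain the unit disc. *)
Definition level_band (s h : R) : set (R * R) :=
  [set w | dist2 w <= 4 /\ `|K w - s| <= h].

Lemma measurable_dist2 : measurable_fun setT (fun w : RR => dist2 w : R).
Proof.
apply: measurable_funD; apply: measurable_funX; last exact: measurable_snd.
by apply: measurable_funD; [exact: measurable_fst|exact: measurable_cst].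
Qed.

Lemma measurable_twisted_sqn : measurable_fun setT (fun w : RR => K w : R).
Proof.
have mf : measurable_fun setT f.
  apply: continuous_measurable_fun => q.
  by apply/differentiable_continuous/derivable1_diffP; exact: ex_derive.
have mfd : measurable_fun setT (fun w : RR => f (dist2 w)).
  exact: (measurableT_comp mf measurable_dist2).
have mX : measurable_fun setT (fun w : RR => w.1 - m).
  by apply: measurable_funD; [exact: measurable_fst|exact: measurable_cst].
rewrite (_ : (fun w => _) = (fun w : RR => m ^+ 2 + dist2 w + 2 * m *
  (cos (f (dist2 w)) * (w.1 - m) + sin (f (dist2 w)) * w.2))); last first.
  by apply/funext => w; rewrite twisted_sqnE.
apply: measurable_funD.
  by apply: measurable_funD; [exact: measurable_cst|exact: measurable_dist2].
apply: measurable_funM; first exact: measurable_cst.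
have mc : measurable_fun setT (fun w : RR => cos (f (dist2 w))).
  exact: (measurableT_comp (continuous_measurable_fun (@continuous_cos R)) mfd).
have ms : measurable_fun setT (fun w : RR => sin (f (dist2 w))).
  exact: (measurableT_comp (continuous_measurable_fun (@continuous_sin R)) mfd).
have m2 : measurable_fun setT (fun w : RR => w.2 : R) by exact: measurable_snd.
exact: (measurable_funD (measurable_funM mc mX) (measurable_funM ms m2)).
Qed.

Lemma measurable_le_fun (g : R * R -> R) (c : R) :
  measurable_fun setT (g : RR -> R) -> measurable ([set w | g w <= c] : set RR).
Proof.
move=> mg; have := mg measurableT `]-oo, c]%classic (measurable_itv _).
by rewrite setTI; congr measurable; apply/seteqP; split => w /=; rewrite in_itv.
Qed.

Lemma measurable_level_band s h : measurable (level_band s h : set RR).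
Proof.
apply: measurableI; first exact: (measurable_le_fun 4 measurable_dist2).
apply: (@measurable_le_fun (fun w => `|K w - s|)).
apply: measurableT_comp; first exact: normr_measurable.
by apply: measurable_funD; [exact: measurable_twisted_sqn|exact: measurable_cst].
Qed.

Lemma rot_fst_polar (u : R * R) : exists th, forall t,
  (rot t u).1 = Num.sqrt (sqn u) * cos (t - th).
Proof.
have [th eth] := polar u; exists th => t; move: eth.
by move: (Num.sqrt _) => rho ->; rewrite cosB /rot /=; ring.
Qed.

(** Along a circle about (m, 0) the function K is a sinusoid in the angle whose amplitude does not
    involve [f]; the twist only shifts its argument. *)
Lemma twisted_sqn_rot_about w : exists x : R, forall al,
  K (rot_about m al w) = m ^+ 2 + dist2 w + 2 * m * (Num.sqrt (dist2 w) * cos (x + al)).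
Proof.
have [th eth] := rot_fst_polar (shiftx (- m) w).
exists (f (dist2 w) - th) => al; rewrite twisted_sqnE /rot_about shiftxK sqn_rot rotD eth.
by congr (_ + _ * (_ * cos _)); ring.
Qed.

Lemma dist2_rot_about al w : dist2 (rot_about m al w) = dist2 w.
Proof. by rewrite /rot_about shiftxK sqn_rot. Qed.

Lemma dist2_box (r : R) w : 0 <= r -> dist2 w <= r ^+ 2 ->
  (`[m - r, m + r]%classic `*` `[- r, r]%classic) w.
Proof.
move=> r0 wr; have wx : `|w.1 - m| <= r.
  by apply: norm_le_sqr => //; rewrite (le_trans _ wr)// lerDl sqr_ge0.
have wy : `|w.2| <= r.
  by apply: norm_le_sqr => //; rewrite (le_trans _ wr)// lerDr sqr_ge0.
split => /=; rewrite in_itv /=; last by rewrite -ler_norml.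
by rewrite -ler_distl.
Qed.

Lemma lebesgue2_disc_le (r : R) : 0 <= r -> forall A : set (R * R),
  (forall w, A w -> dist2 w <= r ^+ 2) -> (mu2 A <= (4 * r ^+ 2)%:E)%E.
Proof.
move=> r0 A Ar.
apply: (@le_trans _ _ (mu2 (`[m - r, m + r]%classic `*` `[- r, r]%classic))).
  by apply: le_lebesgue2 => w /Ar; exact: dist2_box.
rewrite lebesgue2_box; [|lra|lra].
by rewrite lee_fin; lra.
Qed.

(* A point meets few of the k sets if the sets are rotated copies of one thin
   set, so each of them has measure O(1/k). *)
Lemma lebesgue2_few_overlaps (k : nat) (A B : set (R * R)) (T : 'I_k -> set (R * R)) :
  measurable (B : set RR) -> (forall j, measurable (T j : set RR)) ->
  (forall j, mu2 (T j) = mu2 A) -> (forall j, T j `<=` B) ->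
  (forall w, (#|[pred j | asbool (T j w)]| <= 2)%N) ->
  ((k%:R)%:E * mu2 A <= 2%:E * mu2 B)%E.
Proof.
move=> mB mT TA TB T2.
have -> : ((k%:R)%:E * mu2 A = \sum_(j < k) \int[mu2]_w (\1_(T j) w)%:E)%E.
  rewrite (eq_bigr (fun=> mu2 A)); last first.
    by move=> j _; rewrite integral_indic// setIT TA.
  by rewrite sumr_const card_ord muleC mule_natr.
rewrite -ge0_integral_sum//; last first.
  by move=> j; apply/measurable_EFinP/measurable_indicP.
have -> : (2%:E * mu2 B = \int[mu2]_w (2 * \1_B w)%:E)%E.
  under eq_integral do rewrite EFinM.
  rewrite ge0_integralZl//; last by apply/measurable_EFinP/measurable_indicP.
  by rewrite integral_indic// setIT.
apply: ge0_le_integral => //.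
- by move=> w _; apply: sume_ge0 => j _; rewrite lee_fin.
- by apply: emeasurable_sum => j; apply/measurable_EFinP/measurable_indicP.
- apply/measurable_EFinP/measurable_funM => //; exact/measurable_indicP.
move=> w _; rewrite sumEFin lee_fin.
have [Bw|nBw] := pselect (B w); last first.
  rewrite big1 ?mulr_ge0// => j _; rewrite indicE memNset// => /TB.
  exact: nBw.
rewrite indicE mem_set// mulr1.
have -> : \sum_(i < k) \1_(T i) w = (#|[pred j | asbool (T j w)]|)%:R :> R.
  rewrite -sum1_card natr_sum [RHS]big_mkcond /=; apply: eq_bigr => j _.
  have <- : (w \in T j) = (j \in [pred j | asbool (T j w)]).
    by apply/idP/asboolP => [/set_mem|/mem_set].
  by rewrite indicE; case: (w \in T j).
by rewrite ler_nat.
Qed.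

(** Dividing by the amplitude, which is at least 2 m rho, turns closeness of the values of K into
    closeness of cosines, to which [cos_three_points] applies. *)
Lemma twisted_sqn_three_angles (w : R * R) (s h rho a1 a2 a3 d : R) :
  0 < rho -> 0 < d -> rho ^+ 2 <= dist2 w ->
  d <= `|a1 - a2| <= 1 -> d <= `|a2 - a3| <= 1 -> d <= `|a1 - a3| <= 1 ->
  `|K (rot_about m a1 w) - s| <= h -> `|K (rot_about m a2 w) - s| <= h ->
  `|K (rot_about m a3 w) - s| <= h ->
  cos 1 ^+ 2 * d ^+ 2 * (m * rho) <= 4 * h.
Proof.
move=> rho0 d0 rw d12 d23 d13; have [x Kx] := twisted_sqn_rot_about w; rewrite !Kx.
set D := _ + dist2 w; set rt := Num.sqrt _ => k1 k2 k3.
have rt0 : rho <= rt by rewrite -[rho](ger0_norm (ltW rho0)) -sqrtr_sqr ler_wsqrtr.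
have mr : 0 < m * rho by rewrite mulr_gt0.
have cosd a b : `|D + 2 * m * (rt * cos (x + a)) - s| <= h ->
    `|D + 2 * m * (rt * cos (x + b)) - s| <= h -> `|cos (x + a) - cos (x + b)| <= h / (m * rho).
  move=> ka kb; rewrite ler_pdivlMr//.
  have : `|2 * m * rt * (cos (x + a) - cos (x + b))| <= 2 * h.
    rewrite (_ : _ * _ = (D + 2 * m * (rt * cos (x + a)) - s) - (D + 2 * m * (rt * cos (x + b)) - s)).
      by rewrite (le_trans (ler_normB _ _))//; lra.
    by ring.
  have m_rt : m * rho <= m * rt by rewrite ler_pM2l.
  rewrite normrM (ger0_norm (_ : 0 <= 2 * m * rt)); last first.
    by rewrite !mulr_ge0 ?(ltW m_gt0)// (le_trans (ltW rho0)).
  have := ler_wpM2l (normr_ge0 (cos (x + a) - cos (x + b))) m_rt.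
  by nra.
have dd a b : (x + a) - (x + b) = a - b by ring.
have := @cos_three_points R (x + a1) (x + a2) (x + a3) d (h / (m * rho)) d0.
rewrite !dd => /(_ d12 d23 d13 (cosd _ _ k1 k2) (cosd _ _ k2 k3)).
by rewrite mulrA ler_pdivlMr.
Qed.

(** Near (m, 0) the amplitude of the sinusoid degenerates: a small disc there is estimated by its
    area, the rest of the band by counting overlaps of its rotated copies. *)
Lemma lebesgue2_level_band (e : R) : 0 < e ->
  exists2 h, 0 < h & forall s, (mu2 (level_band s h) <= e%:E)%E.
Proof.
(* The disc of radius [rho] has measure at most 4 rho^2 = e/2. *)
move=> e0; pose rho := Num.sqrt (e / 8).
have rho2 : rho ^+ 2 = e / 8 by rewrite sqr_sqrtr// divr_ge0// ltW.
have rho0 : 0 < rho by rewrite sqrtr_gt0 divr_gt0.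
(* The k copies lie in a set of measure at most 16 and overlap at most twice, so k times the measure
   of one is at most 32; k >= 64/e makes that measure at most e/2. The angles are the multiples of
   [d] in [0, 1]. *)
pose k := (Num.truncn (64 / e)).+1; pose d : R := k%:R^-1.
have k0 : 0 < k%:R :> R by rewrite ltr0n.
have d0 : 0 < d by rewrite invr_gt0.
have kge : 64 / e <= k%:R by rewrite ltW// truncnS_gt.
have c1 := @cos1_gt0 R.
(* Here 4 h is half of the left-hand side in [twisted_sqn_three_angles], so no point lies in three
   of the rotated copies. *)
pose h := cos 1 ^+ 2 * d ^+ 2 * (m * rho) / 8.
have h0 : 0 < h by rewrite !(mulr_gt0, exprn_gt0, invr_gt0).
exists h => // s.
pose A := level_band s h `&` [set w | rho ^+ 2 <= dist2 w].
have mA : measurable (A : set RR).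
  apply: measurableI; first exact: measurable_level_band.
  rewrite (_ : [set w | _] = [set w | - dist2 w <= - rho ^+ 2]); last first.
    by apply/seteqP; split => w /=; rewrite lerN2.
  apply: measurable_le_fun; apply: measurableT_comp; first exact: oppr_measurable.
  exact: measurable_dist2.
pose al (j : 'I_k) : R := j%:R * d.
have al01 j : 0 <= al j <= 1.
  by rewrite mulr_ge0 ?(ltW d0)//= ler_pdivrMr// mul1r ler_nat ltnW.
have al_sep i j : i != j -> d <= `|al i - al j| <= 1.
  move=> ij; apply/andP; split; last by have := al01 i; have := al01 j; rewrite ler_norml; lra.
  rewrite -mulrBl normrM (gtr0_norm d0) ler_peMl ?(ltW d0)//.
  wlog ltij : i j ij / (i < j)%N.
    move=> H; have [/H->//|ji|/val_inj/eqP] := ltngtP i j; last by rewrite (negPf ij).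
    by rewrite distrC; apply: H => //; rewrite eq_sym.
  by rewrite distrC ger0_norm ?subr_ge0 ?ler_nat ?(ltnW ltij)// -natrB ?(ltnW ltij)// ler1n subn_gt0.
pose T j := rot_about m (al j) @^-1` A.
have c0 j : 1 + cos (al j) != 0.
  rewrite gt_eqF// ltr_wpDr// cos_ge0_pihalf//.
  have := al01 j; have := @pihalf_ge1 R; lra.
have B16 : (mu2 [set w | (dist2 w <= 4)%R] <= 16%:E)%E.
  have E4 : 2 ^+ 2 = 4 :> R by ring.
  have := @lebesgue2_disc_le 2 (ler0n _ _) [set w | dist2 w <= 2 ^+ 2] (fun w h => h).
  by rewrite E4 => /le_trans; apply; rewrite lee_fin; lra.
have := @lebesgue2_few_overlaps k A [set w | dist2 w <= 4] T.
have mB : measurable ([set w | dist2 w <= 4] : set RR) by exact: (measurable_le_fun 4 measurable_dist2).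
move=> /(_ mB).
have mT j : measurable (T j : set RR) by exact: measurable_rot_about.
move=> /(_ mT).
have muT j : mu2 (T j) = mu2 A by exact: lebesgue2_rot_about.
move=> /(_ muT).
have TB j : T j `<=` [set w | dist2 w <= 4].
  by move=> w [[/= ]]; rewrite dist2_rot_about.
move=> /(_ TB).
have T2 w : (#|[pred j | asbool (T j w)]| <= 2)%N.
  rewrite leqNgt; apply/negP => /card_gt2P[i1 [i2 [i3 [[]]]]].
  move=> p1 p2 p3 [n12 n23 n31].
  have [[_ k1] r1] : T i1 w := asboolW p1.
  have [[_ k2] _] : T i2 w := asboolW p2.
  have [[_ k3] _] : T i3 w := asboolW p3.
  rewrite /= dist2_rot_about in r1; rewrite eq_sym in n31.
  have := twisted_sqn_three_angles rho0 d0 r1 (al_sep _ _ n12) (al_sep _ _ n23)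
    (al_sep _ _ n31) k1 k2 k3.
  apply/negP; rewrite -ltNge /h.
  have : 0 < cos 1 ^+ 2 * d ^+ 2 * (m * rho) by rewrite !(mulr_gt0, exprn_gt0).
  lra.
move=> /(_ T2) kA.
have A2 : (mu2 A <= (e / 2)%:E)%E.
  have := le_trans kA (lee_wpmul2l _ B16); rewrite lee_fin => /(_ (ler0n _ 2)).
  rewrite -EFinM -lee_pdivlMl// => /le_trans; apply; rewrite -EFinM lee_fin.
  rewrite mulrC ler_pdivrMr//; have : 64 / e * (e / 2) <= k%:R * (e / 2).
    by rewrite ler_pM2r// divr_gt0.
  have -> : 64 / e * (e / 2) = 32 by field; rewrite gt_eqF.
  by lra.
apply: (@le_trans _ _ (mu2 (A `|` [set w | dist2 w <= rho ^+ 2]%R))).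
  apply: le_lebesgue2 => w wl; have [wr|wr] := leP (dist2 w) (rho ^+ 2); first by right.
  by left; split => //=; exact: ltW.
have mD : measurable ([set w | dist2 w <= rho ^+ 2] : set RR).
  exact: (measurable_le_fun _ measurable_dist2).
apply: (le_trans (measureU2 _ mA mD)).
have := @lebesgue2_disc_le rho (ltW rho0) [set w | dist2 w <= rho ^+ 2] (fun w h => h).
rewrite rho2 => D2; rewrite (_ : e%:E = (e / 2)%:E + (4 * (e / 8))%:E)%E; last first.
  by rewrite -EFinD; congr (_%:E); field.
exact: leeD.
Qed.

End ThinSets.

(** * Simply connected hulls *)

Section Hull.
Context {R : realType}.
Implicit Types (T C D : set (R * R)).

(** The complement of [C] is connected and unbounded, so a component of the complement of
    [closure T] that meets it contains all of it and cannot be bounded. *)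
Lemma hull_sub T C : T `<=` C -> closed C -> bounded_set C -> connected (~` C) ->
  hull T `<=` C.
Proof.
move=> TC cC bC kC.
have clC : closure T `<=` C by rewrite closureE => w; apply.
move=> w [/clC//|[D [[v Tv <-] bD] Dw]].
apply: contrapT => nCw.
have sub : ~` C `<=` connected_component (~` closure T) v.
  rewrite (same_connected_component Dw); apply: connected_component_max => //.
  by move=> u nCu /clC.
have [M1 [_ HM1]] := bC; have [M2 [_ HM2]] := bD.
(* The point (x, 0) lies beyond the bounds of both [C] and the component [D]. *)
pose x := `|M1| + `|M2| + 2.
have xE : `|(x, 0) : R * R| = x.
  rewrite prod_normE /= normr0 ger0_norm ?addr_ge0//.
  by apply/max_idPl; rewrite addr_ge0// addr_ge0.
have lt1 (M : R) : M < `|M| + 1 by rewrite ltr_pwDr// ler_norm.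
have [Cx|/sub Dx] := pselect (C (x, 0)).
  have /= := HM1 _ (lt1 _) _ Cx; rewrite xE.
  by apply/negP; rewrite -ltNge /x; have := normr_ge0 M2; lra.
have /= := HM2 _ (lt1 _) _ Dx; rewrite xE.
by apply/negP; rewrite -ltNge /x; have := normr_ge0 M1; lra.
Qed.

Lemma connected_curve (g : R -> R * R) : continuous g -> connected (range g).
Proof.
move=> cg; apply: connected_continuous_connected; last exact: continuous_subspaceT.
by apply/connected_intervalP; rewrite -set_itvNyy; exact: interval_is_interval.
Qed.

Variables (m R0 : R) (f f' : R -> R).
Hypotheses (m_gt0 : 0 < m) (mR0 : m < R0) (mR1 : m + R0 <= 1).
Hypothesis f_derive : forall q, is_derive q (1 : R) f (f' q).
Hypothesis f_pi : f (m ^+ 2) = pi.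
Hypothesis f_out : forall q, R0 ^+ 2 <= q -> f q = 0.
Notation K := (twisted_sqn m f).
Notation flow := (twisted_flow m f).

Variables (A r : R) (J : set R).
Hypotheses (A0 : 0 <= A) (Am : A < (2 * m) ^+ 2) (mr : (m + R0) ^+ 2 <= r) (r1 : r <= 1) (Ar : A <= r).
Hypothesis closedJ : closed J.

(** On the segment from the displaced centre (2m, 0) to (1, 0) K goes from 0 to 1. Hence every level
    curve has a point on the axis at distance at least 2m, outside of the disc [sqn w <= A]. *)
Lemma twisted_sqn_ray (s : R) : 0 <= s <= 1 -> exists2 t, 2 * m <= t & K (t, 0) = s.
Proof.
move=> s01.
have := mR0; have := mR1; have := m_gt0 => m_gt0' mR1' mR0'.
have m1 : 2 * m <= 1 by lra.
have K1 : K (1, 0) = 1.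
  rewrite (twisted_sqn_out f_out) /sqn /= ?expr0n ?addr0 ?expr1n//.
  by rewrite ler_pXn2r// ?nnegrE; lra.
have cK : {within `[2 * m, 1], continuous (fun t => K (t, 0))}.
  apply: continuous_subspaceT; apply: (continuous_twisted_sqn f_derive).
  by apply: continuous_pair => t; [exact: cvg_id|exact: cvg_cst].
have [|t /itvP tm <-] := IVT m1 cK (v := s); last by exists t => //; rewrite tm.
by rewrite (twisted_sqn_center f_pi) K1 minElt maxElt ltr01.
Qed.

Definition banded_disc : set (R * R) := [set w | sqn w <= A /\ J (K w)].

(** Every point of the complement is joined within it to a fixed ray of the axis: from inside the
    disc along its level curve, on which K keeps a value outside of [J], and from outside the disc
    along a circle about the origin. *)
Lemma connected_banded_discC : connected (~` banded_disc).
Proof.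
have := m_gt0 => m_gt0'.
(* The exponential parametrizes the open ray by the whole line, as [connected_curve] requires. *)
pose ray (t : R) := (Num.sqrt (A + expR t), 0) : R * R.
have cray : continuous ray.
  apply: continuous_pair => t; last exact: cvg_cst.
  apply: (cvg_comp (fun t => A + expR t) Num.sqrt); last exact: sqrt_continuous.
  by apply: cvgD; [exact: cvg_cst|exact: continuous_expR].
have rayP (x : R) : 0 <= x -> A < x ^+ 2 -> range ray (x, 0).
  move=> x0 Ax; exists (ln (x ^+ 2 - A)) => //.
  by rewrite /ray lnK ?posrE ?subr_gt0// subrKC sqrtr_sqr ger0_norm.
have rayC : range ray `<=` ~` banded_disc.
  move=> _ [t _ <-] [/= + _]; rewrite /sqn /= expr0n addr0 sqr_sqrtr ?addr_ge0 ?expR_ge0//.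
  by apply/negP; rewrite -ltNge ltrDl expR_gt0.
have pathE w : (~` banded_disc) w ->
    exists2 g : R -> R * R, continuous g /\ range g `<=` ~` banded_disc &
      range g w /\ (range g `&` range ray) !=set0.
  move=> nBw; have [wA|wA] := leP (sqn w) A.
    have nJ : ~ J (K w) by move=> Jw; apply: nBw.
    have Kw1 : 0 <= K w <= 1.
      rewrite sqn_ge0 (le_trans _ r1)// (twisted_sqn_le m_gt0 mR0 f_out _ mr).
      exact: le_trans wA Ar.
    have [t tm Kt] := twisted_sqn_ray Kw1.
    have [s sE] := twisted_level (esym Kt).
    exists (fun s => flow s w); split.
    - apply: (continuous_twisted_flow f_derive (th := id) (p := fun=> w)) => u; [exact: cvg_id|exact: cvg_cst].
    - by move=> _ [u _ <-] [_]; rewrite /twisted_flow /twisted_sqn twistK sqn_rot.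
    - by exists 0 => //; rewrite /twisted_flow mulr0 rot0 untwistK.
    - exists (t, 0); split; first by exists s.
      apply: rayP; first by lra.
      by rewrite (lt_le_trans Am)// ler_pXn2r// ?nnegrE; lra.
  exists (fun s => rot s w); split.
  - by apply: (continuous_rot (th := id) (p := fun=> w)) => s; [exact: cvg_id|exact: cvg_cst].
  - by move=> _ [s _ <-] [/= + _]; rewrite sqn_rot leNgt wA.
  - by exists 0 => //; rewrite rot0.
  - have [th eth] := polar w; exists (Num.sqrt (sqn w), 0); split.
      exists th => //; rewrite {1}eth; move: (Num.sqrt _) => rho; rewrite /rot /=.
      congr pair; last by ring.
      by rewrite -[RHS]mulr1 -(cos2Dsin2 th); ring.
    by apply: rayP; rewrite ?sqrtr_ge0// sqr_sqrtr ?sqn_ge0.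
have -> : ~` banded_disc = connected_component (~` banded_disc) (ray 0).
  apply/seteqP; split; last exact: connected_component_sub.
  move=> w /pathE[g [cg gB] [gw gray]].
  exists (range g `|` range ray); last by left.
  split; first by right; exists 0.
  - by move=> u [/gB|/rayC].
  - by apply: connectedU => //; exact: connected_curve.
exact: component_connected.
Qed.

(** Since the time depends on the conserved K alone, [th 1] is a homeomorphism with inverse
    [th (-1)]. It maps the banded disc onto a closed set [C] with connected complement, to which
    [hull_sub] applies. *)
Lemma hull_twisted (tau : R -> R) (T : set (R * R)) : continuous tau ->
  T `<=` [set flow (tau (K v)) v | v in banded_disc] ->
  hull T `<=` [set w | sqn w <= r /\ J (K w)].
Proof.
move=> ctau TB.
pose th s (v : R * R) := flow (s * tau (K v)) v.
have Kth s v : K (th s v) = K v by rewrite /th /twisted_flow /twisted_sqn twistK sqn_rot.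
have thK s v : th (- s) (th s v) = v.
  by rewrite {1}/th Kth twisted_flowD mulNr addNr /twisted_flow mulr0 rot0 untwistK.
have cK : continuous (fun v => K v).
  by apply: (continuous_twisted_sqn f_derive (p := id)) => u; exact: cvg_id.
have cth s : continuous (th s).
  apply: (continuous_twisted_flow f_derive (th := fun v => s * tau (K v)) (p := id)) => v; last exact: cvg_id.
  apply: cvgM; first exact: cvg_cst.
  by apply: (cvg_comp (fun v => K v) tau); [exact: cK|exact: ctau].
pose C := th (-1) @^-1` banded_disc.
have imC (D : set (R * R)) : th (-1) @^-1` D = th 1 @` D.
  apply/seteqP; split => [w Dw|_ [v Dv <-]]; last by rewrite /preimage /= thK.
  by exists (th (-1) w) => //; rewrite -{1}[1]opprK thK.
have CE w : C w -> sqn w <= r /\ J (K w).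
  rewrite /C /preimage /= /banded_disc /= Kth => -[wA Jw]; split=> //.
  rewrite -(twisted_sqn_le m_gt0 mR0 f_out _ mr) -(Kth (-1)).
  by rewrite (twisted_sqn_le m_gt0 mR0 f_out _ mr) (le_trans wA).
suff TC : hull T `<=` C by move=> w /TC; exact: CE.
apply: hull_sub.
- by rewrite /C imC => w /TB[v Bv <-]; exists v => //; rewrite /th mul1r.
- apply: (preimage_closed (fun v _ => @cth (-1) v)).
  have cS : continuous (fun v : R * R => sqn v) by apply: (continuous_sqn (p := id)) => u; exact: cvg_id.
  apply: closedI.
    exact: (preimage_closed (fun v _ => cS v) (@closed_le R A)).
  exact: (preimage_closed (fun v _ => cK v) closedJ).
- exists 1; split => // M M1 w /CE[wr _] /=.
  have w1 (x : R) : x ^+ 2 <= sqn w -> `|x| <= 1.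
    by move=> xw; apply: norm_le_sqr => //; rewrite expr1n (le_trans xw)// (le_trans wr).
  by rewrite prod_normE /= (le_trans _ (ltW M1))// ge_max !w1// ?lerDl ?lerDr sqr_ge0.
- have -> : ~` C = th (-1) @^-1` (~` banded_disc) by [].
  rewrite imC; apply: connected_continuous_connected.
    exact: connected_banded_discC.
  exact: continuous_subspaceT.
Qed.

End Hull.

(** * Integrable flows on the phase space *)

Section IntegrableFlow.
Context {R : realType} {n : nat}.
Notation V := (phase_space R n).
Implicit Types (z v : V) (l : 'I_n).

Definition row_pt z l : R * R := (z l 0, z l 1).

Variables (k kx ky : 'I_n -> R * R -> R) (P : 'I_n -> R -> R * R -> R * R).
Hypothesis planeP : forall l, plane_hamiltonian (k l) (kx l) (ky l) (P l).

Definition row_diff z v l := kx l (row_pt z l) * v l 0 + ky l (row_pt z l) * v l 1.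

Lemma row_curve z v l :
  is_derive (0 : R) (1 : R) (fun h => k l (row_pt (h *: v + z) l)) (row_diff z v l).
Proof.
have dc j : is_derive (0 : R) (1 : R) (fun h : R => (h *: v + z) l j) (v l j).
  rewrite (_ : (fun h => _) = (fun h => v l j * h + z l j)).
    exact: is_derive_affine.
  by apply/funext => h; rewrite !mxE mulrC.
have := plane_chain (planeP l) (dc 0) (dc 1).
by rewrite scale0r add0r.
Qed.

Section HamiltonianFlow.
Variables (H : V -> R) (a : 'I_n -> V -> R).
Hypothesis H_smooth : smooth H.
Hypothesis H_curve : forall z v,
  is_derive (0 : R) (1 : R) (fun h => H (h *: v + z)) (\sum_l a l z * row_diff z v l).
Hypothesis a_invariant : forall z z',
  (forall l, k l (row_pt z l) = k l (row_pt z' l)) -> forall l, a l z = a l z'.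

Definition product_flow (t : R) z : V := \matrix_(l, j)
  (if j == 0 then (P l (t * a l z) (row_pt z l)).1 else (P l (t * a l z) (row_pt z l)).2).

Lemma row_pt_product_flow t z l : row_pt (product_flow t z) l = P l (t * a l z) (row_pt z l).
Proof. by rewrite /row_pt !mxE /=; case: (P l _ _). Qed.

Lemma diff_curve z v : 'd H z v = \sum_l a l z * row_diff z v l.
Proof.
rewrite -deriveE; last exact: (smooth_diff z H_smooth).
have [_ <-] := H_curve z v; apply: (congr1 (fun g : R -> R => lim (g @ 0^'))).
by apply/funext => h /=; rewrite scale0r add0r addr0 /GRing.scale /= mulr1.
Qed.

(** The differential of H is the sum of the [a l] times the differentials of the [k l]. As the [a l]
    are functions of the conserved [k l], they are constant in time, and each row runs through its
    own plane flow at constant speed. *)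
Lemma product_flow_hamiltonian : is_hamiltonian_flow H product_flow.
Proof.
exists (fun z => \matrix_(l, j) (a l z * (if j == 0 then ky l (row_pt z l) else - kx l (row_pt z l)))).
  move=> z v; rewrite diff_curve /omega0; apply: eq_bigr => l _.
  by rewrite !mxE /= /row_diff; ring.
split=> [z|z t].
  apply/matrixP => l j; rewrite mxE mul0r (plane_flow0 (planeP l)).
  by case: (eqVneq j 0) => [->//|j0] /=; congr (z l _); apply/val_inj; move: j j0 => [[|[|]]].
have aE l : a l (product_flow t z) = a l z.
  by apply: a_invariant => l'; rewrite row_pt_product_flow (plane_conserved (planeP l')).
have dta l : is_derive t (1 : R) (fun s => s * a l z) (a l z).
  have := is_derive_affine (a l z) 0 t.
  by congr is_derive; apply/funext => s; rewrite addr0 mulrC.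
have dE l j : is_derive t (1 : R) (fun s => product_flow s z l j)
    (a l z * (if j == 0 then ky l (P l (t * a l z) (row_pt z l)) else - kx l (P l (t * a l z) (row_pt z l)))).
  rewrite (_ : (fun s => _) = (fun s => if j == 0 then (P l (s * a l z) (row_pt z l)).1
      else (P l (s * a l z) (row_pt z l)).2)); last by apply/funext => s; rewrite mxE.
  rewrite mulrC; case: ifP => _.
    exact: (curve_comp (plane_flow_fst (planeP l) (row_pt z l)) (dta l)).
  exact: (curve_comp (plane_flow_snd (planeP l) (row_pt z l)) (dta l)).
have dphi : derivable (product_flow ^~ z) t 1.
  by apply/derivable_mxP => l j; exact: (@ex_derive _ _ _ _ _ _ _ (dE l j)).
apply: DeriveDef => //; rewrite derive_mx//; apply/matrixP => l j; rewrite !mxE.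
by rewrite (@derive_val _ _ _ _ _ _ _ (dE l j)) aE row_pt_product_flow.
Qed.

End HamiltonianFlow.
End IntegrableFlow.

Section OscillatingHamiltonian.
Context {R : realType} {n : nat}.
Notation V := (phase_space R n.+1).
Implicit Types (z v : V) (l : 'I_n.+1).
Variables (k kx ky : 'I_n.+1 -> R * R -> R) (P : 'I_n.+1 -> R -> R * R -> R * R).
Hypothesis planeP : forall l, plane_hamiltonian (k l) (kx l) (ky l) (P l).
Variables (i : 'I_n.+1) (eps N : R) (chi chi' xi xi' : R -> R).
Hypotheses (chi_smooth : @preserves_smooth R n.+1 chi) (xi_smooth : @preserves_smooth R n.+1 xi).
Hypothesis chi_derive : forall x, is_derive x (1 : R) chi (chi' x).
Hypothesis xi_derive : forall x, is_derive x (1 : R) xi (xi' x).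

Let kz l z := k l (row_pt z l).
(** The conserved quantity seen by the cut-off [xi]. When all summands are squared distances, a
    bound on it bounds every row but the first. *)
Definition transverse_sum z := \sum_(l | l != ord0) kz l z.
Definition phase z := N * kz i z + kz ord0 z.
Definition osc_hamiltonian z :=
  eps * (sin (phase z) * (chi (kz ord0 z) * xi (transverse_sum z))).
(** The partial derivative of the Hamiltonian with respect to [k l]. *)
Definition osc_speed l z := eps *
  (cos (phase z) * chi (kz ord0 z) * xi (transverse_sum z) * (N * (l == i)%:R + (l == ord0)%:R) +
   sin (phase z) * chi' (kz ord0 z) * xi (transverse_sum z) * (l == ord0)%:R +
   sin (phase z) * chi (kz ord0 z) * xi' (transverse_sum z) * (l != ord0)%:R).
Definition osc_flow := product_flow P osc_speed.

Lemma smooth_sum (I : Type) (r : seq I) (p : pred I) (F : I -> V -> R) :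
  (forall j, smooth (F j)) -> smooth (fun z => \sum_(j <- r | p j) F j z).
Proof.
move=> sF; elim: r => [|j r IH].
  by rewrite (_ : (fun z => _) = cst 0); [exact: smooth_cst|apply/funext => z; rewrite big_nil].
rewrite (_ : (fun z => _) = (fun z => (if p j then F j z else 0) + \sum_(j <- r | p j) F j z)).
  by apply: smoothD => //; case: (p j) => //; exact: smooth_cst.
by apply/funext => z; rewrite big_cons; case: (p j); rewrite ?add0r.
Qed.

Lemma curve_sum (I : Type) (r : seq I) (p : pred I) (F : I -> R -> R) (dF : I -> R) t :
  (forall j, is_derive t (1 : R) (F j) (dF j)) ->
  is_derive t (1 : R) (fun s => \sum_(j <- r | p j) F j s) (\sum_(j <- r | p j) dF j).
Proof.
move=> dFj; elim: r => [|j r IH].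
  rewrite big_nil (_ : (fun s => _) = fun=> 0); first exact: curve_cst.
  by apply/funext => s; rewrite big_nil.
rewrite (_ : (fun s => _) = (fun s => (if p j then F j s else 0) + \sum_(j <- r | p j) F j s)).
  rewrite (_ : \sum_(_ <- _ | _) _ = (if p j then dF j else 0) + \sum_(j <- r | p j) dF j).
    by apply: (curveD _ IH); case: (p j) => //; exact: curve_cst.
  by rewrite big_cons; case: (p j); rewrite ?add0r.
by apply/funext => s; rewrite big_cons; case: (p j); rewrite ?add0r.
Qed.

Lemma smooth_osc_hamiltonian : smooth osc_hamiltonian.
Proof.
have sk l : smooth (kz l) by exact: (plane_smooth (planeP l)).
apply: smoothM; first exact: smooth_cst.
apply: smoothM.
  apply: (preserves_smooth_sin (F := phase)); apply: smoothD => //.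
  by apply: smoothM => //; exact: smooth_cst.
apply: smoothM; first exact: (chi_smooth (F := kz ord0)).
by apply: (xi_smooth (F := transverse_sum)); exact: smooth_sum.
Qed.

Lemma osc_curve z v : is_derive (0 : R) (1 : R) (fun h => osc_hamiltonian (h *: v + z))
  (\sum_l osc_speed l z * row_diff kx ky z v l).
Proof.
have dk l := row_curve planeP z v l.
have dQ := @curve_sum _ (index_enum 'I_n.+1) (fun l => l != ord0) _ _ _ dk.
have dph := curveD (curveM (curve_cst 0 N) (dk i)) (dk ord0).
have := curveM (curve_cst 0 eps) (curveM (curve_sin dph)
  (curveM (curve_comp chi_derive (dk ord0)) (curve_comp xi_derive dQ))).
move/is_derive_val; apply; rewrite scale0r add0r mul0r add0r.
rewrite -/(kz ord0 z) -/(kz i z) -/(phase z) -/(transverse_sum z).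
pose D l := row_diff kx ky z v l; rewrite -/(D ord0) -/(D i).
pose sD := \sum_(l | l != ord0) D l; rewrite -[\sum_(j <- _ | j != ord0) row_diff _ _ _ _ j]/sD.
have delta (c : R) j : \sum_l c * (l == j)%:R * D l = c * D j.
  rewrite (bigD1 j)//= eqxx mulr1 big1 ?addr0// => l /negPf->.
  by rewrite mulr0 mul0r.
have deltaN (c : R) : \sum_l c * (l != ord0)%:R * D l = c * \sum_(l | l != ord0) D l.
  rewrite mulr_sumr [RHS]big_mkcond; apply: eq_bigr => l _.
  by case: (l != ord0); rewrite ?mulr1// mulr0 mul0r.
set ph := phase z; set c0 := chi _; set c0' := chi' _; set x0 := xi _; set x0' := xi' _.
rewrite [RHS](eq_bigr (fun l => (eps * cos ph * c0 * x0 * N) * (l == i)%:R * D l +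
  (eps * cos ph * c0 * x0 + eps * sin ph * c0' * x0) * (l == ord0)%:R * D l +
  (eps * sin ph * c0 * x0') * (l != ord0)%:R * D l)); last first.
  by move=> l _; rewrite /osc_speed -/ph -/c0 -/c0' -/x0 -/x0' -/(D l); ring.
rewrite !big_split /= !delta deltaN -/sD.
by move: sD (D ord0) (D i) => a b c; ring.
Qed.

Lemma osc_flow_hamiltonian : is_hamiltonian_flow osc_hamiltonian osc_flow.
Proof.
apply: (product_flow_hamiltonian planeP smooth_osc_hamiltonian osc_curve) => z z' kE l.
have kzE l' : kz l' z = kz l' z' by exact: kE.
rewrite /osc_speed /phase /transverse_sum !kzE.
by rewrite (eq_bigr (fun l => kz l z')).
Qed.

End OscillatingHamiltonian.

(** * Sections by the fibers *)

(** The first centre is arbitrary in [A], the second any point of [A] farther than [h] from it; a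
    point near neither would complete a forbidden triple. *)
Lemma two_intervals {R : realType} (A : set R) (h : R) :
  (forall s1 s2 s3, A s1 -> A s2 -> A s3 ->
     h < `|s1 - s2| -> h < `|s2 - s3| -> h < `|s1 - s3| -> False) ->
  exists a1 a2, forall s, A s -> `|s - a1| <= h \/ `|s - a2| <= h.
Proof.
move=> A3; have [[a1 Aa1]|A0] := pselect (exists a, A a); last first.
  by exists 0, 0 => s As; exfalso; apply: A0; exists s.
have [[a2 [Aa2 a12]]|A1] := pselect (exists a, A a /\ h < `|a - a1|); last first.
  exists a1, a1 => s As; left; rewrite leNgt; apply/negP => hs.
  by apply: A1; exists s.
exists a1, a2 => s As.
have [|s1] := leP `|s - a1| h; first by left.
have [|s2] := leP `|s - a2| h; first by right.
by exfalso; apply: (A3 s a2 a1) => //.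
Qed.

(** The bound 3 e counts two level bands and a boundary layer. Sets inside the smaller cylinder
    avoid the layer, whence 2 e for the hulls. *)
Definition small_sections {R : realType} {n : nat} (S : set (phase_space R n.+1)) (e a : R) :=
  exists H psi, [/\ hamiltonians S H, is_time1_map H psi, (Hnorm H <= (2 * e)%:E)%E,
    forall x, (outer_lebesgue2 (plane_proj @` (psi @` S `&` fiber x)) <= (3 * e)%:E)%E &
    (forall z, S z -> sqn (row_pt z ord0) <= a) ->
      forall x, (mu_hat (plane_proj @` (psi @` S `&` fiber x)) <= (2 * e)%:E)%E].

Section FiberSections.
Context {R : realType} {n : nat}.
Notation V := (phase_space R n.+1).
Implicit Types (z v : V) (l : 'I_n.+1).
Variables (m R0 : R) (f f' : R -> R).
Hypotheses (m_gt0 : 0 < m) (mR0 : m < R0) (mR1 : m + R0 <= 1).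
Hypothesis f_derive : forall q, is_derive q (1 : R) f (f' q).
Hypothesis f_pi : f (m ^+ 2) = pi.
Hypothesis f_out : forall q, R0 ^+ 2 <= q -> f q = 0.
Notation K := (twisted_sqn m f).
Notation mu2 := (@lebesgue2 R).

Variables (e h r r' : R).
Hypotheses (e_gt0 : 0 < e) (h_gt0 : 0 < h).
Hypothesis band_le : forall s, (mu2 (level_band m f s h) <= e%:E)%E.
(** By [rh], the layer r < K <= 1, where [chi] need not be 1, fits into a single level band about
    the value 1. *)
Hypotheses (mr : (m + R0) ^+ 2 <= r) (rr' : r < r') (r'1 : r' <= 1) (rh : 1 - r <= h).

Variables (k kx ky : 'I_n.+1 -> R * R -> R) (P : 'I_n.+1 -> R -> R * R -> R * R).
Hypothesis planeP : forall l, plane_hamiltonian (k l) (kx l) (ky l) (P l).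
Hypotheses (k0 : k ord0 = K) (P0 : P ord0 = twisted_flow m f).
Variables (i : 'I_n.+1) (A eta : R) (chi chi' xi xi' : R -> R) (S : set V).
Hypothesis i_neq0 : i != ord0.
Hypotheses (chi_smooth : @preserves_smooth R n.+1 chi) (xi_smooth : @preserves_smooth R n.+1 xi).
Hypothesis chi_derive : forall x, is_derive x (1 : R) chi (chi' x).
Hypothesis xi_derive : forall x, is_derive x (1 : R) xi (xi' x).
Hypothesis chi_in : forall x, x <= r -> chi x = 1 /\ chi' x = 0.
Hypothesis chi_out : forall x, r' <= x -> chi x = 0.
Hypotheses (chi01 : forall x, 0 <= chi x <= 1) (xi01 : forall x, 0 <= xi x <= 1).
Hypothesis xi_in : forall z, S z -> xi (transverse_sum k z) = 1 /\ xi' (transverse_sum k z) = 0.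
(** The form in which the bound on [S] confines the starting point of z_i: two points of [S] brought
    to the same endpoint were moved during nearly the same time. *)
Hypothesis separation : forall z z' (c c' : R), S z -> S z' -> -1 <= c <= 1 -> -1 <= c' <= 1 ->
  P i (A * c) (row_pt z i) = P i (A * c') (row_pt z' i) -> `|c - c'| <= eta.
Hypothesis eta_small : 4 * eta < cos 1 ^+ 2 * h ^+ 2.

Let N := A / e.
Notation H := (osc_hamiltonian k i e N chi xi).
Notation phi := (osc_flow k P i e N chi chi' xi xi').
Notation ph := (phase k i N).

Lemma osc_hamiltonian_norm z : `|H z| <= e.
Proof.
rewrite /osc_hamiltonian normrM (gtr0_norm e_gt0) ger_pMr//.
rewrite normrM mulr_ile1 ?sin_max// normrM mulr_ile1//.
  by rewrite ger0_norm; case/andP: (chi01 (k ord0 (row_pt z ord0))).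
by rewrite ger0_norm; case/andP: (xi01 (transverse_sum k z)).
Qed.

Lemma osc_hamiltonian_supp z : H z != 0 -> sqn (row_pt z ord0) <= 1 /\ xi (transverse_sum k z) != 0.
Proof.
rewrite /osc_hamiltonian !mulf_eq0 !negb_or => /and4P[_ _ chi0 xi0]; split => //.
have mr' : (m + R0) ^+ 2 <= r' by exact: le_trans mr (ltW rr').
apply: le_trans r'1; rewrite -(twisted_sqn_le m_gt0 mR0 f_out _ mr').
rewrite leNgt; apply: contra chi0 => kr; rewrite k0 chi_out// ltW//.
Qed.

Lemma osc_speed_in z l : S z -> K (row_pt z ord0) <= r -> l = i \/ l = ord0 ->
  osc_speed k i e N chi chi' xi xi' l z =
  cos (ph z) * (A * (l == i)%:R + e * (l == ord0)%:R).
Proof.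
move=> Sz Kr li; have [x1 x0] := xi_in Sz; have [c1 c0] := chi_in Kr.
rewrite /osc_speed k0 x1 x0 c1 c0 /N.
by field; rewrite gt_eqF.
Qed.

Lemma phi_row z l : row_pt (phi 1 z) l = P l (osc_speed k i e N chi chi' xi xi' l z) (row_pt z l).
Proof. by rewrite /osc_flow row_pt_product_flow mul1r. Qed.

Lemma K_phi z : K (row_pt (phi 1 z) ord0) = K (row_pt z ord0).
Proof. by rewrite phi_row -k0 (plane_conserved (planeP ord0)). Qed.

Lemma fiber_section (x : phase_space R n) : exists kap a1 a2, forall z, S z ->
  fiber x (phi 1 z) -> K (row_pt z ord0) <= r ->
  row_pt (phi 1 z) ord0 = twisted_flow m f (e * cos (kap + K (row_pt z ord0))) (row_pt z ord0) /\
  (`|K (row_pt z ord0) - a1| <= h \/ `|K (row_pt z ord0) - a2| <= h).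
Proof.
have [i' iE] : exists i', i = lift ord0 i'.
  by case: (unliftP ord0 i) i_neq0 => [i' -> _|->]; [exists i'|rewrite eqxx].
pose y := (x i' 0, x i' 1).
have rowy z : fiber x (phi 1 z) -> row_pt (phi 1 z) i = y.
  by rewrite /y /row_pt iE => -[_ <-]; congr pair; rewrite [RHS]mxE.
(* By conservation k(z_i) may be evaluated at the endpoint [y], which is common to the whole fiber
   because row [i] is not the first one. *)
pose kap := N * k i y.
have phE z : fiber x (phi 1 z) -> ph z = kap + K (row_pt z ord0).
  move=> /rowy zy; rewrite /phase -k0 /kap -zy phi_row (plane_conserved (planeP i)) //.
pose B := [set s | exists2 z, S z /\ fiber x (phi 1 z) & K (row_pt z ord0) <= r /\ s = K (row_pt z ord0)].
have Bcos s s' : B s -> B s' -> `|cos (kap + s) - cos (kap + s')| <= eta.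
  move=> [z [Sz fz] [zr ->]] [z' [Sz' fz'] [zr' ->]].
  apply: (separation Sz Sz'); rewrite ?cos_geN1 ?cos_le1//.
  rewrite -(phE _ fz) -(phE _ fz').
  have sp u : S u -> K (row_pt u ord0) <= r -> fiber x (phi 1 u) -> P i (A * cos (ph u)) (row_pt u i) = y.
    move=> Su ur fu; rewrite -(rowy _ fu) phi_row osc_speed_in//; last by left.
    by rewrite eqxx (negPf i_neq0) mulr1 mulr0 addr0 mulrC.
  by rewrite !sp.
(* This supplies the upper bound 1 on distances in [cos_three_points]. *)
have B01 s : B s -> 0 <= s <= 1.
  move=> [z _ [zr ->]]; rewrite sqn_ge0 (le_trans zr)// (le_trans (ltW rr'))//.
have [|a1 [a2 Ha]] := @two_intervals R B h.
  move=> s1 s2 s3 B1 B2 B3 h12 h23 h13.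
  have kd s s' : (kap + s) - (kap + s') = s - s' by ring.
  have d1 s s' : B s -> B s' -> h < `|s - s'| -> h <= `|(kap + s) - (kap + s')| <= 1.
    move=> /B01 s01 /B01 s01' hs; rewrite kd (ltW hs) /= ler_norml; lra.
  have := cos_three_points h_gt0 (d1 _ _ B1 B2 h12) (d1 _ _ B2 B3 h23) (d1 _ _ B1 B3 h13)
    (Bcos _ _ B1 B2) (Bcos _ _ B2 B3).
  by rewrite leNgt eta_small.
exists kap, a1, a2 => z Sz fz zr; split; last by apply: Ha; exists z.
rewrite phi_row P0 osc_speed_in//; last by right.
by rewrite eqxx eq_sym (negPf i_neq0) mulr1 mulr0 add0r mulrC (phE _ fz).
Qed.

Lemma disc_pi (w : R * R) : disc pi w -> sqn w <= 1.
Proof. by rewrite /disc /= -[leRHS]mulr1 ler_pM2l// pi_gt0. Qed.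

Lemma sqn_le_dist2 (w : R * R) : sqn w <= 1 -> sqn (shiftx (- m) w) <= 4.
Proof.
have := mR0; have := mR1; have := m_gt0 => a b c w1.
have : `|w.1| <= 1.
  by apply: norm_le_sqr => //; rewrite expr1n (le_trans _ w1)// lerDl sqr_ge0.
rewrite ler_norml => w11; move: w1; rewrite /sqn /shiftx /=; nra.
Qed.

Notation bands a1 a2 := (level_band m f a1 h `|` level_band m f a2 h).

Let mb s : measurable (level_band m f s h : set (measurableTypeR R * measurableTypeR R)).
Proof. exact: (measurable_level_band _ f_derive). Qed.

Lemma bands_le a1 a2 : (mu2 (bands a1 a2) <= (2 * e)%:E)%E.
Proof.
apply: (le_trans (measureU2 _ (mb a1) (mb a2))).
by rewrite mulr_natl mulr2n EFinD; apply: leeD; exact: band_le.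
Qed.

Lemma section_outer (x : phase_space R n) :
  (outer_lebesgue2 (plane_proj @` (phi 1 @` S `&` fiber x)) <= (3 * e)%:E)%E.
Proof.
have [kap [a1 [a2 Ha]]] := fiber_section x.
(* The third band takes the points with K > r, about whose speed nothing is known; K is conserved
   for them as well. *)
apply: (@le_trans _ _ (mu2 (bands a1 a2 `|` level_band m f 1 h))).
  apply: outer_lebesgue2_le; last by apply: measurableU => //; exact: measurableU.
  move=> _ [_ [[z Sz <-] fz] <-].
  rewrite (_ : plane_proj _ = row_pt (phi 1 z) ord0)//.
  have w1 : sqn (row_pt (phi 1 z) ord0) <= 1 by apply: disc_pi; case: fz.
  have [zr|zr] := leP (K (row_pt z ord0)) r.
    have [_ [ha|ha]] := Ha z Sz fz zr; left; [left|right]; split.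
    - exact: sqn_le_dist2.
    - by rewrite K_phi.
    - exact: sqn_le_dist2.
    - by rewrite K_phi.
  right; split; first exact: sqn_le_dist2.
  have m1 : (m + R0) ^+ 2 <= 1 by rewrite (le_trans mr)// (le_trans (ltW rr')).
  have : K (row_pt (phi 1 z) ord0) <= 1 by rewrite (twisted_sqn_le m_gt0 mR0 f_out _ m1).
  rewrite -K_phi in zr; move: rh zr => /= rh'; rewrite ler_norml; lra.
apply: (le_trans (measureU2 _ (measurableU _ _ (mb a1) (mb a2)) (mb 1))).
rewrite (_ : 3 * e = 2 * e + e); last by ring.
by rewrite EFinD; apply: leeD; [exact: bands_le|exact: band_le].
Qed.

Lemma section_hull (a : R) (x : phase_space R n) : 0 <= a -> a < (2 * m) ^+ 2 -> a <= r ->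
  (forall z, S z -> sqn (row_pt z ord0) <= a) ->
  (mu_hat (plane_proj @` (phi 1 @` S `&` fiber x)) <= (2 * e)%:E)%E.
Proof.
move=> a0 am ar Sa; have [kap [a1 [a2 Ha]]] := fiber_section x.
pose J := [set s | `|s - a1| <= h \/ `|s - a2| <= h].
have r1 : r <= 1 by rewrite (le_trans (ltW rr')).
have cJ : closed J.
  have cb (b : R) : closed [set s | `|s - b| <= h].
    apply: (preimage_closed (f := fun s => `|s - b|) _ (@closed_le R h)) => s _.
    apply: (cvg_comp (fun s => s - b) Num.norm); last exact: norm_continuous.
    by apply: cvgB; [exact: cvg_id|exact: cvg_cst].
  exact: (closedU (cb a1) (cb a2)).
apply: (le_trans _ (bands_le a1 a2)); apply: le_lebesgue2.
(* With [kap] fixed by the fiber, the time of the motion of w extends to a function of K on the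
   whole plane. *)
have ctau : continuous (fun s => e * cos (kap + s)).
  move=> s; apply: cvgM; first exact: cvg_cst.
  apply: (cvg_comp (fun s => kap + s) (@cos R)); last exact: continuous_cos.
  by apply: cvgD; [exact: cvg_cst|exact: cvg_id].
apply: (subset_trans (hull_twisted m_gt0 mR0 mR1 f_derive f_pi f_out a0 am mr r1 ar cJ ctau _)).
  move=> _ [_ [[z Sz <-] fz] <-].
  have zr : K (row_pt z ord0) <= r.
    by rewrite (twisted_sqn_le m_gt0 mR0 f_out _ mr) (le_trans (Sa z Sz)).
  have [zE zJ] := Ha z Sz fz zr.
  by exists (row_pt z ord0); [split => //; exact: Sa|rewrite -zE].
move=> w [wr [ha|ha]]; [left|right]; split => //;
  by apply: sqn_le_dist2; rewrite (le_trans wr).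
Qed.

Lemma Hnorm_osc : (Hnorm H <= (2 * e)%:E)%E.
Proof.
rewrite (_ : 2 * e = e - (- e)); last by ring.
rewrite EFinB /Hnorm; apply: leeB.
  apply: ge_ereal_sup => _ [z _ <-]; rewrite lee_fin.
  exact: le_trans (ler_norm _) (osc_hamiltonian_norm z).
apply: le_ereal_inf_tmp => _ [z _ <-]; rewrite lee_fin.
by have := osc_hamiltonian_norm z; rewrite ler_norml => /andP[].
Qed.

Lemma supp_osc : supp H `<=` cylinder pi.
Proof.
have cl : closed [set z : V | sqn (row_pt z ord0) <= 1].
  apply: (preimage_closed (f := fun z : V => sqn (row_pt z ord0)) _ (@closed_le R 1)) => z _.
  apply: (continuous_sqn (p := fun z : V => row_pt z ord0)).
  by apply: continuous_pair; exact: coord_continuous.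
have sub : supp H `<=` [set z : V | sqn (row_pt z ord0) <= 1].
  rewrite /supp closureE => z; apply; split => // w /= /osc_hamiltonian_supp[].
  by [].
by move=> z /sub /= z1; rewrite /cylinder /disc /= -[leRHS]mulr1 ler_pM2l ?pi_gt0.
Qed.

Lemma osc_small_sections (a : R) : (bounded_set S -> compact (supp H)) ->
  0 <= a -> a < (2 * m) ^+ 2 -> a <= r -> small_sections S e a.
Proof.
move=> cS a0 am ar.
have sH := smooth_osc_hamiltonian planeP i e N chi_smooth xi_smooth.
have flowH := osc_flow_hamiltonian planeP i e N chi_smooth xi_smooth chi_derive xi_derive.
exists H, (phi 1); split.
- split=> [bS|_]; split=> //.
  + exact: cS.
  + exact: supp_osc.
  + exists e; split; first by rewrite num_real.
    by move=> M eM z _ /=; rewrite (le_trans (osc_hamiltonian_norm z))// ltW.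
  + exact: supp_osc.
  + by exists phi.
- by exists phi.
- exact: Hnorm_osc.
- exact: section_outer.
- by move=> Sa x; apply: (section_hull x a0).
Qed.

End FiberSections.

(** * Transverse motions for bounded and unbounded sets *)

Section MatrixBoxes.
Context {R : realType} {p q : nat}.

Lemma compact_matrix_box (M : R) : compact [set z : 'M[R]_(p, q) | forall i j, `|z i j| <= M].
Proof.
pose box := [set v : 'rV[R]_(p * q) | forall i, `[- M, M]%classic (v ord0 i)].
have cb : compact box.
  by apply: (@rV_compact _ _ (fun=> `[- M, M]%classic)) => _; exact: segment_compact.
have cv : continuous (vec_mx : 'rV[R]_(p * q) -> 'M[R]_(p, q)).
  move=> v s /nbhs_ballP[e e0 es]; apply/nbhs_ballP; exists e => //= w [_ vw].
  by apply: es; split => // i j; rewrite !mxE; exact: vw.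
rewrite (_ : [set z | _] = vec_mx @` box).
  apply: continuous_compact cb; exact: continuous_subspaceT.
apply/seteqP; split => [z zM|_ [v vM <-] i j]; last first.
  by rewrite mxE; have := vM (mxvec_index i j); rewrite /= in_itv /= -ler_norml.
exists (mxvec z); last exact: mxvecK.
by move=> l; case/mxvec_indexP: l => i j; rewrite /= mxvecE in_itv /= -ler_norml.
Qed.

Lemma norm_entry_le (z : 'M[R]_(p, q)) i j : `|z i j| <= `|z|.
Proof.
rewrite [leRHS]/Num.Def.normr /= mx_normrE.
exact: (le_bigmax _ (fun x => `|z x.1 x.2|) (i, j)).
Qed.

End MatrixBoxes.

Lemma bounded_setP {R : realType} (V : normedModType R) (A : set V) : bounded_set A ->
  exists2 M : R, 0 <= M & forall x, A x -> `|x| <= M.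
Proof.
move=> [M [_ HM]]; exists (`|M| + 1); first by rewrite addr_ge0.
by move=> x Ax; apply: (HM (`|M| + 1)) => //; rewrite ltr_pwDr// ler_norm.
Qed.

(** The bounded coordinate [j] is the one that moves, at unit speed; the Hamiltonian is its
    conjugate coordinate up to sign. *)
Lemma translation_hamiltonian {R : realType} (j : 'I_2) :
  exists (k kx ky : R * R -> R) (P : R -> R * R -> R * R), plane_hamiltonian k kx ky P /\
    forall t w, (if j == 0 then (P t w).1 else (P t w).2) = (if j == 0 then w.1 else w.2) + t.
Proof.
case: (j == 0).
  by exists (fun w => w.2), (fun=> 0), (fun=> 1), (fun t w => (w.1 + t, w.2)); split; first exact: fst_translation_hamiltonian.
by exists (fun w => - w.1), (fun=> -1), (fun=> 0), (fun t w => (w.1, w.2 + t)); split; first exact: snd_translation_hamiltonian.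
Qed.

Lemma row_pt_coord {R : realType} {n : nat} (z : phase_space R n) l (j : 'I_2) :
  (if j == 0 then (row_pt z l).1 else (row_pt z l).2) = z l j.
Proof. by case: (eqVneq j 0) => [->//|j0] /=; congr (z l _); apply/val_inj; move: j j0 => [[|[|]]]. Qed.

(* A rotation by an angle at most 2 which moves a far away point a little has
   a small angle. *)
Lemma rot_angle_le {R : realType} (d M L : R) (u : R * R) : 0 <= M -> M < L ->
  `|d| <= 2 -> L - M <= `|u.1| ->
  `|u.1 - (rot d u).1| <= 2 * M -> `|u.2 - (rot d u).2| <= 2 * M ->
  cos 1 * `|d| * (L - M) <= 3 * M.
Proof.
move=> M0 ML d2 uL h1 h2; have c0 := @cos1_gt0 R.
have sq (x y : R) : `|x| <= y -> x ^+ 2 <= y ^+ 2.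
  by move=> xy; rewrite -[x ^+ 2]real_normK ?num_real// ler_pXn2r// nnegrE (le_trans _ xy).
pose s := sin (d / 2).
have dd : d = d / 2 + d / 2 by field.
have cd : cos d = 1 - 2 * s ^+ 2.
  by rewrite {1}dd cosD -!expr2 cos2sin2 /s; ring.
(* The chord of a rotation by [d] has squared length 4 sin(d/2)^2 times the squared radius. *)
have H : 4 * s ^+ 2 * (u.1 ^+ 2 + u.2 ^+ 2) <= 2 * (2 * M) ^+ 2.
  have -> : 4 * s ^+ 2 * (u.1 ^+ 2 + u.2 ^+ 2) =
      (u.1 - (rot d u).1) ^+ 2 + (u.2 - (rot d u).2) ^+ 2.
    transitivity ((1 - 2 * cos d + (cos d ^+ 2 + sin d ^+ 2)) * (u.1 ^+ 2 + u.2 ^+ 2)).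
      by rewrite cos2Dsin2 cd; ring.
    by rewrite /rot /=; ring.
  by have := lerD (sq _ _ h1) (sq _ _ h2); lra.
(* The constant 3 comes from 8 M^2 <= 9 M^2. *)
have {}H : (2 * (`|s| * `|u.1|)) ^+ 2 <= (3 * M) ^+ 2.
  rewrite !exprMn !real_normK ?num_real//.
  have := sqr_ge0 s; have := sqr_ge0 u.2; have := sqr_ge0 M; nra.
have {}H : 2 * (`|s| * `|u.1|) <= 3 * M.
  rewrite (le_trans (ler_norm _))// norm_le_sqr// mulr_ge0//.
have n2 : `|d / 2| = `|d| / 2 by rewrite normrM normfV (ger0_norm (_ : 0 <= 2)).
have := @sin_ge_linear R (d / 2); rewrite n2 -/s => /(_ _) sl.
have {}sl : cos 1 * (`|d| / 2) <= `|s| by apply: sl; lra.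
have LM : 0 <= L - M by lra.
have := ler_pM (mulr_ge0 (ltW c0) (_ : 0 <= `|d| / 2)) LM sl uL.
by move=> /(_ (divr_ge0 (normr_ge0 _) (ler0n _ 2))) H'; lra.
Qed.

Definition by_row {T : Type} {n : nat} (i : 'I_n.+1) (x0 xi xo : T) (l : 'I_n.+1) :=
  if l == ord0 then x0 else if l == i then xi else xo.

Section PartiallyBounded.
Context {R : realType} {n : nat}.
Notation V := (phase_space R n.+1).
Variables (m R0 : R) (f f' : R -> R).
Hypotheses (m_gt0 : 0 < m) (mR0 : m < R0) (mR1 : m + R0 <= 1).
Hypothesis f_smooth : forall n, @preserves_smooth R n f.
Hypothesis f_derive : forall q, is_derive q (1 : R) f (f' q).
Hypothesis f_pi : f (m ^+ 2) = pi.
Hypothesis f_out : forall q, R0 ^+ 2 <= q -> f q = 0.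
Variables (e h r r' : R).
Hypotheses (e_gt0 : 0 < e) (h_gt0 : 0 < h).
Hypothesis band_le : forall s, (lebesgue2 (level_band m f s h) <= e%:E)%E.
Hypotheses (mr : (m + R0) ^+ 2 <= r) (rr' : r < r') (r'1 : r' <= 1) (rh : 1 - r <= h).
Variables (S : set V) (i : 'I_n.+1) (j : 'I_2) (a : R).
Hypotheses (i_neq0 : i != ord0) (bSij : bounded_set [set z i j | z in S]).
Hypotheses (a0 : 0 <= a) (am : a < (2 * m) ^+ 2) (ar : a <= r).

(** Chosen so that 4 eta is half of the bound in [cos_three_points]. *)
Let eta := cos 1 ^+ 2 * h ^+ 2 / 8.

Let eta_gt0 : 0 < eta.
Proof. by rewrite divr_gt0// mulr_gt0 ?exprn_gt0 ?cos1_gt0. Qed.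

Let eta_small : 4 * eta < cos 1 ^+ 2 * h ^+ 2.
Proof.
have : 0 < cos 1 ^+ 2 * h ^+ 2 by rewrite mulr_gt0 ?exprn_gt0 ?cos1_gt0.
rewrite /eta; move: (cos 1 ^+ 2 * h ^+ 2) => x; lra.
Qed.

Let by_rowP (ki kxi kyi ko kxo kyo : R * R -> R) Pi Po :
  plane_hamiltonian ki kxi kyi Pi -> plane_hamiltonian ko kxo kyo Po ->
  forall l, plane_hamiltonian (by_row i (twisted_sqn m f) ki ko l)
    (by_row i (twisted_dx m f f') kxi kxo l) (by_row i (twisted_dy m f f') kyi kyo l)
    (by_row i (twisted_flow m f) Pi Po l).
Proof.
move=> Hi Ho l; rewrite /by_row; case: ifP => _; last by case: ifP.
exact: twisted_hamiltonian.
Qed.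

Let by_row_i (T : Type) (x0 xi xo : T) : by_row i x0 xi xo i = xi.
Proof. by rewrite /by_row eqxx (negPf i_neq0). Qed.

(** The remaining rows are kept at rest and [xi] is constant: [Hb] admits supports that are
    unbounded in the transverse directions. *)
Lemma small_sections_unbounded : ~ bounded_set S -> small_sections S e a.
Proof.
move=> nbS; have [chi [chi' [chi_sm chi_d chi_in chi_out chi01]]] := smooth_cutoff rr'.
have [ki [kxi [kyi [Pi [Hi Pij]]]]] := @translation_hamiltonian R j.
have [M M0 HM] := bounded_setP bSij.
(* A eta exceeds 2 M, the largest possible difference of the bounded coordinate between two points
   of [S]. *)
pose A := (2 * M + 1) / eta.
have A0 : 0 < A by rewrite divr_gt0// ltr_wpDl// mulr_ge0.
apply: (osc_small_sections (A := A) (eta := eta) (xi := fun=> 1) (xi' := fun=> 0)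
  m_gt0 mR0 mR1 f_derive f_pi f_out e_gt0 h_gt0 band_le mr rr' r'1 rh
  (by_rowP Hi zero_hamiltonian) _ _ i_neq0 (chi_sm _) _ chi_d _ chi_in chi_out chi01) => //.
- exact: preserves_smooth_cst.
- by move=> x; rewrite ler01 lexx.
- move=> z z' c c' Sz Sz' _ _; rewrite by_row_i => Pe.
  have := Pij (A * c) (row_pt z i); rewrite Pe Pij !row_pt_coord => zz'.
  have : A * `|c - c'| <= 2 * M.
    rewrite -{1}(gtr0_norm A0) -normrM mulrBr.
    rewrite (_ : A * c - A * c' = z' i j - z i j); last by move: zz'; lra.
    have := HM (z i j) (ex_intro2 _ _ z Sz erefl).
    have := HM (z' i j) (ex_intro2 _ _ z' Sz' erefl).
    by have := ler_normB (z' i j) (z i j); lra.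
  rewrite /A mulrAC ler_pdivrMr// mulrC => Hc.
  rewrite leNgt; apply/negP => ce.
  have := eta_gt0; have : 0 < 2 * M + 1 by lra.
  move: ce Hc; move: `|c - c'| eta => x y; nra.
Qed.

(** Every transverse row carries a squared distance, so that cutting off their sum makes the support
    compact. *)
Lemma small_sections_bounded : bounded_set S -> small_sections S e a.
Proof.
move=> bS; have [chi [chi' [chi_sm chi_d chi_in chi_out chi01]]] := smooth_cutoff rr'.
have [M M0 HM'] := bounded_setP bS.
have HM z l j' : S z -> `|z l j'| <= M.
  by move=> Sz; apply: le_trans (HM' z Sz); exact: norm_entry_le.
have c1 := @cos1_gt0 R.
(* With this distance of the centre, [rot_angle_le] bounds cos 1 times the angle times L - M by 3 M,
   while an angle above [eta] would give more than 3 M + 1. *)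
pose L := M + (3 * M + 1) / (cos 1 * eta).
have ce0 : 0 < cos 1 * eta by rewrite mulr_gt0.
have LM : 0 < (3 * M + 1) / (cos 1 * eta) by rewrite divr_gt0// ltr_wpDl// mulr_ge0.
pose k := by_row i (twisted_sqn m f) (fun w => sqn (shiftx (- L) w)) (fun w => sqn (shiftx (- 0) w)).
pose b : R := (M + L + 1) ^+ 2 + M ^+ 2.
pose Q0 : R := \sum_(l < n.+1 | l != ord0) b.
have Q00 : 0 <= Q0 by apply: sumr_ge0 => l _; rewrite addr_ge0 ?sqr_ge0.
have QS z : S z -> transverse_sum k z <= Q0.
  move=> Sz; apply: ler_sum => l l0; rewrite /k /by_row (negPf l0) /b.
  have L0 : 0 <= L by rewrite addr_ge0// ltW.
  have sq (x y : R) : `|x| <= y -> x ^+ 2 <= y ^+ 2.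
    by move=> xy; rewrite -[x ^+ 2]real_normK ?num_real// ler_pXn2r// nnegrE (le_trans _ xy).
  have z0 := HM z l 0 Sz; have z1 := HM z l 1 Sz.
  by case: ifP => _; apply: lerD; apply: sq => //=;
    rewrite (le_trans (ler_normB _ _))// ?normr0 ?(ger0_norm L0); lra.
have k_ge0 z l : l != ord0 -> 0 <= k l (row_pt z l).
  by move=> l0; rewrite /k /by_row (negPf l0); case: ifP => _; exact: sqn_ge0.
have Q01 : Q0 < Q0 + 1 by rewrite ltrDl.
have [xi [xi' [xi_sm xi_d xi_in xi_out xi01]]] := smooth_cutoff Q01.
(* The rotation flow turns by twice the time, so A = 1/2 turns row [i] by the cosine itself, and two
   such angles differ by at most 2. *)
apply: (osc_small_sections (A := 2^-1) (eta := eta)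
  m_gt0 mR0 mR1 f_derive f_pi f_out e_gt0 h_gt0 band_le mr rr' r'1 rh
  (by_rowP (rot_hamiltonian L) (rot_hamiltonian 0)) _ _ i_neq0 (chi_sm _) (xi_sm _)
  chi_d xi_d chi_in chi_out chi01 xi01) => //.
- by move=> z Sz; exact/xi_in/QS.
- move=> z z' c c' Sz Sz' c_1 c'_1; rewrite by_row_i => Pe.
  have {}Pe : rot c (shiftx (- L) (row_pt z i)) = rot c' (shiftx (- L) (row_pt z' i)).
    by apply: (can_inj (shiftxK L)); move: Pe; rewrite !mulrA divff// !mul1r.
  set u := shiftx (- L) (row_pt z i) in Pe.
  have u'E : shiftx (- L) (row_pt z' i) = rot (c - c') u.
    by rewrite -[LHS](rotK c') -Pe rotD addrC.
  have z0 := HM z i 0 Sz; have z1 := HM z i 1 Sz.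
  have z'0 := HM z' i 0 Sz'; have z'1 := HM z' i 1 Sz'.
  have ML : M < L by rewrite ltrDl.
  have := @rot_angle_le R (c - c') M L u M0 ML.
  rewrite -u'E /u /= => /(_ _ _ _ _) H.
  have {}H : cos 1 * `|c - c'| * (L - M) <= 3 * M.
    apply: H.
    + by rewrite ler_norml; lra.
    + by rewrite -normrN opprB (le_trans _ (ler_norm _))//; move: z0; rewrite ler_norml; lra.
    + rewrite (_ : _ - _ = z i 0 - z' i 0); last by ring.
      by rewrite (le_trans (ler_normB _ _))//; lra.
    + by rewrite (le_trans (ler_normB _ _))//; lra.
  rewrite leNgt; apply/negP => ce.
  have : cos 1 * eta * (L - M) < cos 1 * `|c - c'| * (L - M).
    by rewrite ltr_pM2r ?ltr_pM2l// subr_gt0.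
  have -> : cos 1 * eta * (L - M) = 3 * M + 1.
    by rewrite /L addrAC subrr add0r mulrC divfK// gt_eqF.
  lra.
(* On the support every squared distance is at most Q0 + 1, which is below (Q0 + 2)^2; L allows for
   the displaced centre. *)
move=> _; set B := L + Q0 + 2.
have sub : supp (osc_hamiltonian k i e (2^-1 / e) chi xi) `<=`
    [set z : V | forall l j', `|z l j'| <= B].
  rewrite /supp closureE => z; apply; split.
    apply: compact_closed; [exact: norm_hausdorff|exact: compact_matrix_box].
  move=> w /= Hw l j'.
  have [w1 xi0] : sqn (row_pt w ord0) <= 1 /\ xi (transverse_sum k w) != 0.
    apply: (osc_hamiltonian_supp m_gt0 mR0 f_out mr rr' r'1 _ chi_out Hw).
    by [].
  have wQ : transverse_sum k w <= Q0 + 1.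
    by rewrite leNgt; apply: contra xi0 => /ltW /xi_out ->.
  have L0 : 0 <= L by rewrite addr_ge0// ltW.
  have comp (c : R) : 0 <= c <= L -> sqn (shiftx (- c) (row_pt w l)) <= Q0 + 1 -> `|w l j'| <= B.
    move=> cL wc.
    have wn (x : R) : x ^+ 2 <= sqn (shiftx (- c) (row_pt w l)) -> `|x| <= Q0 + 2.
      by move=> xw; apply: norm_le_sqr; [lra|nra].
    have := wn (w l 0 - c) (_ : _ <= _); have := wn (w l 1) (_ : _ <= _).
    rewrite /sqn /= lerDl lerDr !sqr_ge0 => /(_ isT) h1 /(_ isT) h0.
    rewrite -row_pt_coord /B; case: ifP => _ /=; move: h1 h0; rewrite !ler_norml; lra.
  have [l0|l0] := eqVneq l ord0.
    by apply: (comp 0); [rewrite lexx L0|rewrite l0 oppr0 /shiftx /= addr0; lra].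
  have kl : k l (row_pt w l) <= Q0 + 1.
    apply: le_trans wQ; rewrite /transverse_sum (bigD1 l)//= lerDl.
    by apply: sumr_ge0 => l' /andP[l'0 _]; exact: k_ge0.
  move: kl; rewrite /k /by_row (negPf l0); case: ifP => _ kl.
    by apply: (comp L) => //; rewrite L0 lexx.
  by apply: (comp 0) => //; rewrite lexx L0.
apply: subclosed_compact _ (@compact_matrix_box R n.+1 2 B) sub.
exact: closed_closure.
Qed.

End PartiallyBounded.

Lemma small_sections_exist {R : realType} {n : nat} (S : set (phase_space R n.+1)) (e a : R) :
  partially_bounded S -> 0 < e -> 0 <= a < 1 -> small_sections S e a.
Proof.
move=> [i [j [i0 bS]]] e0 /andP[a0 a1].
(* The value (2m)^2 = (1 + a)/2 lies strictly between a and 1, and (m + R0)^2 lies halfway between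
   it and 1. Hence m < R0, which leaves [f] room to fall from pi to 0. *)
pose b := Num.sqrt ((1 + a) / 2); pose m := b / 2.
pose R0 := Num.sqrt ((b ^+ 2 + 1) / 2) - m.
have b2 : b ^+ 2 = (1 + a) / 2 by rewrite sqr_sqrtr//; lra.
have b_gt0 : 0 < b by rewrite sqrtr_gt0; lra.
have m0 : 0 < m by rewrite divr_gt0.
have mb : 2 * m = b by rewrite /m; field.
have mR : m + R0 = Num.sqrt ((b ^+ 2 + 1) / 2) by rewrite /R0; ring.
have r0E : (m + R0) ^+ 2 = (b ^+ 2 + 1) / 2 by rewrite mR sqr_sqrtr// b2; lra.
have mR0 : m < R0.
  rewrite -(ltrD2l m) mR (_ : m + m = b); last by rewrite -mb; ring.
  rewrite -{1}(gtr0_norm b_gt0) -sqrtr_sqr ltr_sqrt b2; lra.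
have mR1 : m + R0 <= 1 by rewrite mR -[leRHS]sqrtr1 ler_wsqrtr// b2; lra.
have m2R2 : m ^+ 2 < R0 ^+ 2.
  by rewrite ltr_pXn2r// nnegrE ltW// (lt_trans m0).
have [st [st' [st_sm st_d st_in st_out _]]] := smooth_cutoff m2R2.
pose f (q : R) := pi * st q + 0; pose f' (q : R) := pi * st' q.
have f_smooth k : @preserves_smooth R k f.
  exact: (preserves_smooth_comp (preserves_smooth_affine _ _) (st_sm k)).
have f_derive (q : R) : is_derive q (1 : R) f (f' q).
  have := curve_comp (is_derive_affine pi 0) (st_d q).
  by [].
have f_pi : f (m ^+ 2) = pi by rewrite /f (st_in _ _).1// mulr1 addr0.
have f_out (q : R) : R0 ^+ 2 <= q -> f q = 0 by move=> /st_out; rewrite /f => ->; rewrite mulr0 addr0.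
have [h h0 band_le] := lebesgue2_level_band m0 f_derive e0.
(* The width [h] depends only on [m], [f] and [e], so the boundary layer can be made thinner than
   [h] afterwards. *)
pose r := Num.max ((m + R0) ^+ 2) (1 - h).
have r1 : r < 1 by rewrite gt_max r0E b2; apply/andP; split; lra.
have mr : (m + R0) ^+ 2 <= r by rewrite le_max lexx.
have rr' : r < (r + 1) / 2 by lra.
have r'1 : (r + 1) / 2 <= 1 by lra.
have rh : 1 - r <= h.
  by have : 1 - h <= r by [rewrite le_max lexx orbT]; lra.
have am : a < (2 * m) ^+ 2 by rewrite mb b2; lra.
have ar : a <= r by rewrite (le_trans _ mr)// r0E b2; lra.
have [bdS|nbdS] := pselect (bounded_set S).
  exact: (small_sections_bounded m0 mR0 mR1 f_smooth f_derive f_pi f_out e0 h0 band_le mr rr' r'1 rh i0).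
exact: (small_sections_unbounded m0 mR0 mR1 f_smooth f_derive f_pi f_out e0 h0 band_le mr rr' r'1 rh i0 bS).
Qed.

Lemma section_inf_eq0 {R : realType} {n : nat} (mu : set (R * R) -> \bar R)
    (S : set (phase_space R n.+1)) :
  (forall T, (0 <= mu T)%E) ->
  (forall e : R, 0 < e -> exists H psi, [/\ hamiltonians S H, is_time1_map H psi,
    (Hnorm H <= (2 * e)%:E)%E &
    forall x, (mu (plane_proj @` (psi @` S `&` fiber x)) <= (3 * e)%:E)%E]) ->
  section_inf mu S = 0%E.
Proof.
move=> mu0 small; apply/eqP; rewrite eq_le; apply/andP; split.
  apply/lee_addgt0Pr => e e0; rewrite add0e.
  (* Three fifths of [e] go to the sections and two fifths to the norm. *)
  have e50 : 0 < e / 5 by rewrite divr_gt0.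
  have [H [psi [HS Hpsi HN Hmu]]] := small _ e50.
  apply: ge_ereal_inf; exists ((ereal_sup [set mu (plane_proj @` (psi @` S `&` fiber x)) | x in setT] + Hnorm H)%E).
    by exists (H, psi).
  rewrite (_ : e = 3 * (e / 5) + 2 * (e / 5)); last by field.
  rewrite EFinD; apply: leeD => //.
  by apply: ge_ereal_sup => _ [x _ <-]; exact: Hmu.
apply: le_ereal_inf_tmp => _ [[H psi] _ <-] /=; apply: adde_ge0.
  apply: (@le_trans _ _ (mu (plane_proj @` (psi @` S `&` fiber 0)))); first exact: mu0.
  by apply: ereal_sup_ubound; exists 0.
rewrite /Hnorm; apply: (@le_trans _ _ ((H 0)%:E - (H 0)%:E)%E); first by rewrite subee.
by apply: leeB; [apply: ereal_sup_ubound|apply: ereal_inf_lbound]; exists 0.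
Qed.

Theorem theorem2p4 (R : realType) (n : nat) (hn : (2 <= n.+1)%N)
    (S : set (phase_space R n.+1))
    (hSZ : S `<=` cylinder pi) (hS : partially_bounded S) :
  sigma_H S = 0%E /\
  ((exists a : R, a < pi /\ S `<=` cylinder a) -> sigma_hat_H S = 0%E).
Proof.
split=> [|[a [api Sa]]].
  apply: section_inf_eq0 => [T|e e0]; first exact: mu_ext_ge0.
  have a01 : 0 <= (0 : R) < 1 by rewrite lexx ltr01.
  have [H [psi [? ? ? outer _]]] := small_sections_exist hS e0 a01.
  by exists H, psi.
apply: section_inf_eq0 => [T|e e0]; first exact: measure_ge0.
have pi0 := pi_gt0 R.
(* The disc of area a has squared radius a / pi; the maximum covers negative a, for which the
   cylinder is empty. *)
have a01 : 0 <= Num.max 0 (a / pi) < 1.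
  by rewrite le_max lexx gt_max ltr01 ltr_pdivrMr// mul1r.
have [H [psi [? ? ? _ hulls]]] := small_sections_exist hS e0 a01.
exists H, psi; split => // x.
apply: le_trans (hulls _ x) _ => [z /Sa|].
  rewrite /cylinder /disc /= => za.
  by rewrite le_max; apply/orP; right; rewrite ler_pdivlMr// mulrC.
by rewrite lee_fin; lra.
Qed.
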